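(* Let $v\equiv 3\pmod 6$ with $v\ge 9$. Then there exists a $(v,3,2)$-BIBD $(X,\mathcal{A})$ that has a strong nesting $\phi:\mathcal{A}\to Y$, $X\subseteq Y$, with $|Y|=w=(3v+1)/2$, and this is optimal: no strong nesting of a $(v,3,2)$-BIBD uses fewer points.
   Context: A $(v,k,\lambda)$-BIBD is a pair $(X,\mathcal{A})$ where $X$ is a set of $v$ points and $\mathcal{A}$ is a multiset of $k$-subsets of $X$ (blocks) such that every pair of distinct points lies in exactly $\lambda$ blocks. Given a $(v,k,\lambda)$-BIBD $(X,\mathcal{A})$ and a set $Y\supseteq X$ with $|Y|=w$, a map $\phi:\mathcal{A}\to Y$ is a strong nesting if (1) $\phi(A)\notin A$ for every block $A\in\mathcal{A}$, and (2) the multiset of pairs $\{\{x,\phi(A)\}: A\in\mathcal{A},\ x\in A\}$ (one pair for each block $A$, counted with multiplicity in $\mathcal{A}$, and each $x\in A$) consists of distinct pairs. A strong nesting is optimal if $w=|Y|$ is as small as possible. *)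

(* Defs.v *)
From mathcomp Require Import all_boot.
Set Implicit Arguments.
Unset Strict Implicit.
Unset Printing Implicit Defensive.

(* A design on the point set X : {set T}, with block multiset given as a
   sequence A of subsets (repetitions = multiplicity). *)
Definition is_BIBD (T : finType) (v k lam : nat) (X : {set T})
    (A : seq {set T}) : Prop :=
  [/\ #|X| = v,
      (forall B, B \in A -> B \subset X /\ #|B| = k) &
      (forall x y, x \in X -> y \in X -> x != y ->
         count (fun B : {set T} => (x \in B) && (y \in B)) A = lam)].

(* Strong nesting phi of the blocks of A (one image per block occurrence,
   indexed by its position in A) into Y ⊇ X. *)
Definition strong_nesting (T : finType) (X Y : {set T})
    (A : seq {set T}) (phi : 'I_(size A) -> T) : Prop :=
  [/\ X \subset Y,
      (forall i, phi i \in Y),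
      (forall i, phi i \notin nth set0 A i) &
      (forall (i j : 'I_(size A)) (x y : T),
         x \in nth set0 A i -> y \in nth set0 A j ->
         [set x; phi i] = [set y; phi j] -> i = j /\ x = y)].

(* Main.v *)
(** Write v = 6t+3 and n = 2t+1; the claimed minimum is then w = 9t+5.

    Lower bound.  The blocks nested at a point outside X are disjoint, so there are at most v/3 of
    them.  If m blocks are nested at a point x of X, then the pairs {x,z} with z in X are used 3m
    times by these blocks and once by each block through x that is nested inside X.  As x lies on
    v-1 blocks, 3m is at most the number of blocks through x nested outside X, so m is at
    most the integer part of W/3, where W = w-v.  Summing over the points bounds the number
    v(v-1)/3 of blocks, which forces W >= 3t+2.

    Construction.  Take X = Z_n x Z_3 and 3t+2 further points.  The i-th further point is assigned
    the n blocks {(x,0), (x+d_i,1), (x+d_i+e_i,2)}, and t base triples, each nested at 0, are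
    developed over Z_n x Z_3.  The nesting is strong when the 6t elements plus or minus a, for a in
    a base triple, are distinct and nonzero.  If the base triples cover each pure difference twice,
    and each element of a set M of size t once as a mixed difference, it remains to choose the
    (d_i,e_i) so that each of the sequences d, e and -(d+e) takes every value h exactly
    2 - [h in M] times.  When M has sum zero this is possible: use (x,x) for x outside M, and for
    the rest (a(x), -c(x)) with a, c bijections whose difference is a prescribed function of sum
    zero; such a, c exist by a theorem of Hall, proved by exchange along a chain.

    The base triples come from a computer search.  For each residue of t modulo 12 they form
    finitely many families of triples whose entries run through arithmetic progressions with
    parameters linear in q, where t = t0 + 12 q; a symbolic check valid for all large q replaces a
    check for each t.  Small t have tables of their own, and v = 9, 21 have explicit block lists. *)
Require Import Defs.
From mathcomp Require Import all_boot.
From Stdlib Require Import ZArith Lia.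
Set Implicit Arguments. Unset Strict Implicit. Unset Printing Implicit Defensive.

(** * Symbolic arithmetic progressions *)

Section SymbolicProgressions.
Local Open Scope Z_scope.

(* [(a, b)] stands for [a + b * q]. *)
Definition lin : Type := Z * Z.
Definition ev (a : lin) (q : Z) : Z := a.1 + a.2 * q.
Definition ladd (a b : lin) : lin := (a.1 + b.1, a.2 + b.2).
Definition lscale (c : Z) (a : lin) : lin := (c * a.1, c * a.2).
Definition lsub (a b : lin) : lin := (a.1 - b.1, a.2 - b.2).

(* The terms [(pbase + pstep * k, plevel)], [0 <= k < plength], of Z_n x Z_3; the integers are read
   modulo n and 3. *)
Record progression := Progression { plevel : Z; pbase : lin; pstep : Z; plength : lin }.
Definition pval (g : progression) (q k : Z) : Z := ev (pbase g) q + pstep g * k.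
Definition popp (g : progression) : progression :=
  Progression (- plevel g) (lscale (-1) (pbase g)) (- pstep g) (plength g).
Definition psub (g h : progression) : progression :=
  Progression (plevel g - plevel h) (lsub (pbase g) (pbase h)) (pstep g - pstep h) (plength g).

(** A nonnegative slope and a positive value at [q0] give positivity at every [q >= q0], so one
    evaluation settles infinitely many cases. *)
Definition posb (q0 : Z) (a : lin) : bool := (0 <=? a.2) && (0 <? ev a q0).
(* Bounds for [c * k] when [0 <= k < l]. *)
Definition upper (c : Z) (l : lin) : lin := if 0 <=? c then lscale c (lsub l (1, 0)) else (0, 0).
Definition lower (c : Z) (l : lin) : lin := if 0 <=? c then (0, 0) else lscale c (lsub l (1, 0)).

(* Three reasons why no term of [g] minus a term of [h] equals [w * n]: it is always too large, always
   too small, or excluded modulo a common divisor of the steps and of the coefficient of q. *)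
Definition apart (n : lin) (q0 : Z) (g h : progression) (w : Z) : bool :=
  let c := lsub (lsub (pbase g) (pbase h)) (lscale w n) in
  [|| posb q0 (ladd c (ladd (lower (pstep g) (plength g)) (lower (- pstep h) (plength h)))),
      posb q0 (lscale (-1) (ladd c (ladd (upper (pstep g) (plength g)) (upper (- pstep h) (plength h))))) |
      ~~ (c.1 mod Z.gcd (Z.gcd (pstep g) (pstep h)) c.2 =? 0)].

(** Terms at different levels cannot coincide. At equal levels the last two tests place every
    difference of terms strictly between -6n and 6n, which leaves eleven multiples of n for [apart]
    to exclude. *)
Definition disjoint_mod (n : lin) (q0 : Z) (g h : progression) : bool :=
  ~~ ((plevel g - plevel h) mod 3 =? 0) ||
  [&& all (apart n q0 g h) [:: -5; -4; -3; -2; -1; 0; 1; 2; 3; 4; 5],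
      posb q0 (ladd (lscale 6 n) (ladd (lsub (pbase g) (pbase h))
        (ladd (lower (pstep g) (plength g)) (lower (- pstep h) (plength h))))) &
      posb q0 (lsub (lscale 6 n) (ladd (lsub (pbase g) (pbase h))
        (ladd (upper (pstep g) (plength g)) (upper (- pstep h) (plength h)))))].

(** Either there is a single term, or the step is nonzero and the whole span stays below n, so that
    the progression never wraps around. *)
Definition injective_mod (n : lin) (q0 : Z) (g : progression) : bool :=
  ((plength g).1 =? 1) && ((plength g).2 =? 0) ||
  ~~ (pstep g =? 0) && posb q0 (lsub n (lscale (Z.abs (pstep g)) (lsub (plength g) (1, 0)))).

Lemma posb_ev q0 q a : posb q0 a -> q0 <= q -> 0 < ev a q.
Proof. by rewrite /posb /ev => /andP[/Z.leb_le ? /Z.ltb_lt ?] ?; nia. Qed.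

Lemma ev_add a b q : ev (ladd a b) q = ev a q + ev b q.
Proof. by rewrite /ev /=; ring. Qed.

Lemma ev_sub a b q : ev (lsub a b) q = ev a q - ev b q.
Proof. by rewrite /ev /=; ring. Qed.

Lemma ev_scale c a q : ev (lscale c a) q = c * ev a q.
Proof. by rewrite /ev /=; ring. Qed.

Lemma upperP c l q k : 0 <= k < ev l q -> c * k <= ev (upper c l) q.
Proof.
rewrite /upper; case: Z.leb_spec => c0 k_l; last by rewrite /ev /=; nia.
by rewrite ev_scale ev_sub; have -> : ev (1, 0) q = 1 by []; nia.
Qed.

Lemma lowerP c l q k : 0 <= k < ev l q -> ev (lower c l) q <= c * k.
Proof.
rewrite /lower; case: Z.leb_spec => c0 k_l; first by rewrite /ev /=; nia.
by rewrite ev_scale ev_sub; have -> : ev (1, 0) q = 1 by []; nia.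
Qed.

Lemma apartP n q0 q g h w k k' : apart n q0 g h w -> q0 <= q ->
  0 <= k < ev (plength g) q -> 0 <= k' < ev (plength h) q ->
  pval g q k - pval h q k' <> w * ev n q.
Proof.
move=> + q0q kg kh E; rewrite /apart.
have := @upperP (pstep g) _ _ _ kg; have := @lowerP (pstep g) _ _ _ kg.
have := @upperP (- pstep h) _ _ _ kh; have := @lowerP (- pstep h) _ _ _ kh.
move: E; rewrite /pval => E L1 U1 L2 U2 /or3P[/posb_ev/(_ q0q)|/posb_ev/(_ q0q)|].
- by rewrite !(ev_add, ev_sub, ev_scale); lia.
- by rewrite !(ev_add, ev_sub, ev_scale); lia.
(* Equality would make [c.1] an integer combination of [c.2] and the two steps, hence a multiple of
   their gcd [d], against the third test. *)
set c := lsub _ _; set d := Z.gcd _ _ => /negP; case; apply/Z.eqb_eq.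
have cE : c.1 = - (c.2 * q) - pstep g * k + pstep h * k'.
  have : ev c q = - pstep g * k + pstep h * k' by rewrite /c !ev_sub ev_scale; lia.
  by rewrite /ev; lia.
have [z1 dc] : (d | c.2) by apply: Z.gcd_divide_r.
have [z2 dg] : (d | pstep g) by apply: Z.divide_trans (Z.gcd_divide_l _ _) (Z.gcd_divide_l _ _).
have [z3 dh] : (d | pstep h) by apply: Z.divide_trans (Z.gcd_divide_l _ _) (Z.gcd_divide_r _ _).
rewrite cE dc dg dh.
have -> : - (z1 * d * q) - z2 * d * k + z3 * d * k' = (- (z1 * q) - z2 * k + z3 * k') * d by ring.
exact: Z_mod_mult.
Qed.

Lemma disjoint_modP n q0 q g h k k' : disjoint_mod n q0 g h -> q0 <= q ->
  0 <= k < ev (plength g) q -> 0 <= k' < ev (plength h) q ->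
  (3 | plevel g - plevel h) -> ~ (ev n q | pval g q k - pval h q k').
Proof.
move=> + q0q kg kh [z3 lev] [w E]; rewrite /disjoint_mod => /orP[/negP|].
  by case; apply/Z.eqb_eq; rewrite lev Z_mod_mult.
case/and3P => aparts /posb_ev/(_ q0q) lo /posb_ev/(_ q0q) hi.
have := @upperP (pstep g) _ _ _ kg; have := @lowerP (pstep g) _ _ _ kg.
have := @upperP (- pstep h) _ _ _ kh; have := @lowerP (- pstep h) _ _ _ kh.
move=> L1 U1 L2 U2; have E' := E; move: lo hi E'; rewrite !(ev_add, ev_sub, ev_scale) /pval => lo hi E'.
have w6 : -6 < w < 6 by nia.
suff /apartP/(_ q0q kg kh) : apart n q0 g h w by apply.
move: aparts => /= /and5P[? ? ? ? /and5P[? ? ? ? /and4P[? ? ? _]]].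
have : w = -5 \/ w = -4 \/ w = -3 \/ w = -2 \/ w = -1 \/ w = 0 \/
  w = 1 \/ w = 2 \/ w = 3 \/ w = 4 \/ w = 5 by lia.
by do 10?[case=> [->//|]] => ->.
Qed.

Lemma injective_modP n q0 q g k k' : injective_mod n q0 g -> q0 <= q ->
  0 <= k < ev (plength g) q -> 0 <= k' < ev (plength g) q ->
  (ev n q | pval g q k - pval g q k') -> k = k'.
Proof.
move=> + q0q kg kg' [w E]; rewrite /injective_mod => /orP[/andP[/Z.eqb_eq l1 /Z.eqb_eq l2]|].
  by move: kg kg'; rewrite /ev l1 l2; lia.
case/andP=> /negP step0 /posb_ev/(_ q0q); rewrite ev_sub ev_scale ev_sub.
have -> : ev (1, 0) q = 1 by [].
have {}step0 : pstep g <> 0 by move=> s0; case: step0; rewrite s0.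
move: E; rewrite /pval => E hn.
have {}E : pstep g * (k - k') = w * ev n q by lia.
have n0 : 0 < ev n q by nia.
have : Z.abs (pstep g) * Z.abs (k - k') < ev n q by nia.
rewrite -Z.abs_mul E Z.abs_mul => w0.
have {}w0 : w = 0 by nia.
by nia.
Qed.

(* A family of triples: common length, then the (level, base, step) of each of the three entries, then
   a colour for each pair of entries.  Colours matter for pure differences only: the pure differences
   of either colour cover every nonzero element once. *)
Definition point : Type := Z * lin * Z.
Definition triple_family : Type := lin * (point * point * point) * (bool * bool * bool).
Definition fam (l0 l1 : Z) (x y z : point) (cxy cyz cxz : bool) : triple_family :=
  ((l0, l1), (x, y, z), (cxy, cyz, cxz)).

Definition arm_progression (f : triple_family) (x : point) : progression :=
  Progression x.1.1 x.1.2 x.2 f.1.1.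
Definition arm1 (f : triple_family) := arm_progression f f.1.2.1.1.
Definition arm2 (f : triple_family) := arm_progression f f.1.2.1.2.
Definition arm3 (f : triple_family) := arm_progression f f.1.2.2.

Definition nest_progressions (F : seq triple_family) : seq progression :=
  flatten [seq [:: arm1 f; arm2 f; arm3 f; popp (arm1 f); popp (arm2 f); popp (arm3 f)] | f <- F].

Definition difference_progressions (F : seq triple_family) : seq (bool * progression) :=
  flatten [seq [:: (f.2.1.1, psub (arm1 f) (arm2 f)); (f.2.1.1, psub (arm2 f) (arm1 f));
                   (f.2.1.2, psub (arm2 f) (arm3 f)); (f.2.1.2, psub (arm3 f) (arm2 f));
                   (f.2.2, psub (arm1 f) (arm3 f)); (f.2.2, psub (arm3 f) (arm1 f))] | f <- F].

Definition at_level (l : Z) (g : progression) : bool := (plevel g - l) mod 3 =? 0.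
Definition pure_progressions (F : seq triple_family) (c : bool) : seq progression :=
  [seq d.2 | d <- difference_progressions F & at_level 0 d.2 && (d.1 == c)].
(** Level 1 suffices: differences are listed with both signs, so those at level 2 are the opposites
    of these. *)
Definition mixed_progressions (F : seq triple_family) : seq progression :=
  [seq d.2 | d <- difference_progressions F & at_level 1 d.2].

Definition separated (n : lin) (q0 : Z) (S : seq progression) : bool :=
  all (injective_mod n q0) S && pairwise (disjoint_mod n q0) S.
(** The single element 0. Placed at the head of a list, it makes the separation test also say that
    the other terms are nonzero. *)
Definition zero_progression : progression := Progression 0 (0, 0) 0 (1, 0).
Definition total_length (S : seq progression) : lin := foldr ladd (0, 0) [seq plength g | g <- S].

Definition quad : Type := Z * Z * Z.
Definition qev (a : quad) (q : Z) : Z := a.1.1 + a.1.2 * q + a.2 * (q * q).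
Definition qadd (a b : quad) : quad := (a.1.1 + b.1.1, a.1.2 + b.1.2, a.2 + b.2).
Definition qmul (a b : lin) : quad := (a.1 * b.1, a.1 * b.2 + a.2 * b.1, a.2 * b.2).
(** Gauss's formula l(2b + s(l-1)) for twice the sum of a progression with first term b, step s and
    length l. Doubling keeps the coefficients of the polynomial in q integral, and is harmless
    because n is odd. *)
Definition double_sum (S : seq progression) : quad :=
  foldr qadd (0, 0, 0) [seq qmul (plength g)
    (ladd (lscale 2 (pbase g)) (lscale (pstep g) (lsub (plength g) (1, 0)))) | g <- S].

Definition lin_eqb (a b : lin) : bool := (a.1 =? b.1) && (a.2 =? b.2).
Definition quad_eqb (a b : quad) : bool :=
  [&& a.1.1 =? b.1.1, a.1.2 =? b.1.2 & a.2 =? b.2].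

(* Valid for [t = e_t] and all [q >= e_q0]; twice the sum of the mixed differences is [n * e_quot]. *)
Record starter_entry := Entry
  { e_t : lin; e_q0 : Z; e_quot : lin; e_fams : seq triple_family }.
(** In the table the quotient is written slope first: [u v] stands for v + u q, whereas [t0 t1]
    stands for t0 + t1 q. *)
Definition entry (t0 t1 q0 u v : Z) F := Entry (t0, t1) q0 (v, u) F.

(** Separation gives distinctness, and the length equalities turn it into exact cover: 2t distinct
    nonzero elements of Z_n, n = 2t+1, are all of them. Each of the two colours of pure differences
    is tested in this way. *)
Definition entry_ok (e : starter_entry) : bool :=
  let t := e_t e in let n := ladd (1, 0) (lscale 2 t) in let q0 := e_q0 e in let F := e_fams e in
  [&& 0 <=? q0, posb q0 t, all (fun f => posb q0 f.1.1) F,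
      separated n q0 (zero_progression :: nest_progressions F),
      separated n q0 (zero_progression :: pure_progressions F true),
      separated n q0 (zero_progression :: pure_progressions F false),
      separated n q0 (mixed_progressions F) &
      [&& lin_eqb (total_length [seq arm1 f | f <- F]) t,
          lin_eqb (total_length (pure_progressions F true)) (lscale 2 t),
          lin_eqb (total_length (pure_progressions F false)) (lscale 2 t),
          lin_eqb (total_length (mixed_progressions F)) t &
          quad_eqb (double_sum (mixed_progressions F)) (qmul n (e_quot e))]].

End SymbolicProgressions.

(** * The table of base triples *)

Section StarterTable.
Local Open Scope Z_scope.

(** The first twelve entries treat the residues of t modulo 12, each from its own threshold on q.
    Every later entry has slope 0 and settles a single t below the threshold of its residue
    class. *)
Definition starter_table : seq starter_entry := [::
  entry 0 12 1 0 4 [::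
    fam (-1) 3 (2,(-8,12),1) (2,(-12,12),-3) (2,(-10,18),-1) false true true;
    fam 0 3 (2,(-9,0),-1) (2,(-7,0),3) (2,(-8,-6),1) false false false;
    fam 0 1 (0,(1,-6),1) (0,(-2,-6),-1) (1,(9,-3),3) true false false;
    fam (-1) 2 (0,(1,-5),1) (0,(-2,-7),-1) (1,(11,-12),3) true false false;
    fam (-1) 2 (0,(1,-3),1) (0,(-2,-9),-1) (1,(11,-6),3) true false false;
    fam 0 1 (0,(0,-1),1) (0,(-1,-11),-1) (1,(10,-12),3) true false false;
    fam 1 0 (2,(-8,6),0) (2,(-8,0),0) (2,(-9,-6),0) true true false;
    fam 1 0 (0,(0,-3),0) (0,(1,9),0) (1,(9,-12),0) true false false;
    fam 1 0 (0,(0,-6),0) (0,(-1,-6),0) (1,(9,-18),0) true false false];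
  entry 1 12 3 12 (-6) [::
    fam 0 3 (2,(1,0),1) (2,(-3,0),-3) (2,(0,6),-1) false false false;
    fam 0 3 (2,(0,-12),-1) (2,(2,-12),3) (2,(0,-18),1) false true true;
    fam (-2) 1 (0,(2,-6),1) (0,(-3,-6),-1) (1,(6,9),3) true false false;
    fam 0 2 (0,(0,-5),1) (0,(-1,-7),-1) (1,(2,0),3) true false false;
    fam (-1) 2 (0,(1,-3),1) (0,(-2,-9),-1) (1,(5,6),3) true false false;
    fam (-1) 1 (0,(0,-1),1) (0,(-1,-11),-1) (1,(4,0),3) true false false;
    fam 1 0 (0,(0,6),0) (0,(-1,-6),0) (0,(1,12),0) true false true;
    fam 1 0 (0,(1,0),0) (0,(0,12),0) (1,(3,9),0) true false false;
    fam 1 0 (0,(1,-6),0) (0,(-2,-6),0) (1,(1,18),0) true false false;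
    fam 1 0 (2,(-1,0),0) (2,(0,0),0) (0,(-1,-9),0) true false false;
    fam 1 0 (0,(0,-3),0) (1,(-1,-6),0) (2,(-2,-6),0) false false false];
  entry 2 12 2 0 (-10) [::
    fam 0 3 (2,(14,12),1) (2,(10,12),-3) (2,(13,18),-1) false false false;
    fam 0 3 (2,(12,0),-1) (2,(14,0),3) (2,(12,-6),1) false true true;
    fam (-1) 1 (0,(0,-6),1) (0,(-3,-6),-1) (1,(-7,-3),3) true false false;
    fam 0 2 (0,(-1,-5),1) (0,(-2,-7),-1) (1,(-12,-12),3) true false false;
    fam (-2) 2 (0,(0,-3),1) (0,(-3,-9),-1) (1,(-9,-6),3) true false false;
    fam (-1) 1 (0,(0,-1),1) (0,(-3,-11),-1) (1,(-11,-12),3) true false false;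
    fam 1 0 (2,(14,18),0) (2,(13,12),0) (2,(12,6),0) false true false;
    fam 1 0 (0,(1,0),0) (0,(2,12),0) (1,(-12,3),0) true false false;
    fam 1 0 (0,(1,1),0) (0,(2,11),0) (1,(-15,0),0) true false false;
    fam 1 0 (0,(-2,-1),0) (0,(-1,-11),0) (1,(-11,6),0) true false false;
    fam 1 0 (0,(1,3),0) (0,(-2,-9),0) (1,(-10,6),0) true false false;
    fam 1 0 (0,(-1,-6),0) (0,(-2,-6),0) (1,(-10,-3),0) true false false];
  entry 3 12 2 12 (-4) [::
    fam 0 3 (2,(1,0),1) (2,(-3,0),-3) (2,(1,6),-1) false true true;
    fam 1 3 (2,(-4,-12),-1) (2,(-2,-12),3) (2,(-5,-18),1) false false false;
    fam (-1) 1 (0,(0,-6),1) (0,(-3,-6),-1) (1,(6,9),3) true false false;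
    fam (-2) 2 (0,(1,-5),1) (0,(-4,-7),-1) (1,(7,0),3) true false false;
    fam 0 2 (0,(0,-3),1) (0,(-3,-9),-1) (1,(4,6),3) true false false;
    fam (-1) 1 (0,(0,-1),1) (0,(-3,-11),-1) (1,(2,0),3) true false false;
    fam 1 0 (0,(1,6),0) (0,(2,6),0) (0,(3,12),0) true true true;
    fam 1 0 (0,(1,0),0) (0,(2,12),0) (1,(3,9),0) true false false;
    fam 1 0 (0,(0,-5),0) (0,(-3,-7),0) (1,(1,6),0) true false false;
    fam 1 0 (0,(-1,-5),0) (0,(-2,-7),0) (1,(1,0),0) true false false;
    fam 1 0 (2,(-3,-12),0) (2,(0,0),0) (0,(-2,-9),0) true false false;
    fam 1 0 (0,(1,3),0) (1,(-1,3),0) (2,(-4,0),0) false false false];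
  entry 4 12 1 0 4 [::
    fam 0 3 (2,(-4,12),1) (2,(-8,12),-3) (2,(-4,18),-1) false true true;
    fam 1 3 (2,(-9,0),-1) (2,(-7,0),3) (2,(-10,-6),1) false false false;
    fam 0 1 (0,(-1,-6),1) (0,(-4,-6),-1) (1,(8,-3),3) true false false;
    fam 0 2 (0,(-1,-5),1) (0,(-4,-7),-1) (1,(6,-12),3) true false false;
    fam 0 2 (0,(0,-3),1) (0,(-5,-9),-1) (1,(9,-6),3) true false false;
    fam 0 1 (0,(0,-1),1) (0,(-5,-11),-1) (1,(7,-12),3) true false false;
    fam 1 0 (2,(-6,6),0) (2,(-8,0),0) (2,(-11,-6),0) true true false;
    fam 1 0 (0,(-1,-3),0) (0,(4,9),0) (1,(5,-12),0) true false false;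
    fam 1 0 (0,(-2,-6),0) (0,(-3,-6),0) (1,(3,-18),0) true false false];
  entry 5 12 2 12 (-2) [::
    fam 1 3 (2,(1,0),1) (2,(-3,0),-3) (2,(2,6),-1) false false false;
    fam 1 3 (2,(-4,-12),-1) (2,(-2,-12),3) (2,(-6,-18),1) false true true;
    fam (-1) 1 (0,(0,-6),1) (0,(-5,-6),-1) (1,(9,9),3) true false false;
    fam 0 2 (0,(-1,-5),1) (0,(-4,-7),-1) (1,(4,0),3) true false false;
    fam (-1) 2 (0,(0,-3),1) (0,(-5,-9),-1) (1,(7,6),3) true false false;
    fam 0 1 (0,(-1,-1),1) (0,(-4,-11),-1) (1,(2,0),3) true false false;
    fam 1 0 (0,(2,6),0) (0,(-3,-6),0) (0,(5,12),0) true false true;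
    fam 1 0 (0,(1,0),0) (0,(4,12),0) (1,(6,9),0) true false false;
    fam 1 0 (0,(-1,-6),0) (0,(-4,-6),0) (1,(7,18),0) true false false;
    fam 1 0 (2,(-1,0),0) (2,(0,0),0) (0,(-4,-9),0) true false false;
    fam 1 0 (0,(-1,-3),0) (1,(-3,-6),0) (2,(-4,-6),0) false false false];
  entry 6 12 2 0 (-30) [::
    fam 1 3 (2,(36,12),1) (2,(32,12),-3) (2,(37,18),-1) false false false;
    fam 1 3 (2,(31,0),-1) (2,(33,0),3) (2,(29,-6),1) false true true;
    fam (-1) 1 (0,(0,-6),1) (0,(-7,-6),-1) (1,(-26,-3),3) true false false;
    fam 0 2 (0,(-1,-5),1) (0,(-6,-7),-1) (1,(-31,-12),3) true false false;
    fam (-1) 2 (0,(0,-3),1) (0,(-7,-9),-1) (1,(-28,-6),3) true false false;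
    fam (-1) 1 (0,(-1,-1),1) (0,(-6,-11),-1) (1,(-33,-12),3) true false false;
    fam 1 0 (2,(34,12),0) (2,(31,6),0) (2,(26,-6),0) false true true;
    fam 1 0 (0,(1,0),0) (0,(-6,-12),0) (1,(-36,-9),0) false false false;
    fam 1 0 (0,(2,0),0) (0,(5,12),0) (1,(-30,3),0) true false false;
    fam 1 0 (0,(1,3),0) (0,(-6,-9),0) (1,(-27,6),0) true false false;
    fam 1 0 (0,(-1,-6),0) (0,(-6,-6),0) (1,(-38,-18),0) true false false;
    fam 1 0 (0,(-2,-6),0) (0,(-5,-6),0) (1,(-28,6),0) true false false;
    fam 1 0 (0,(3,6),0) (0,(4,6),0) (1,(-29,-3),0) true false false];
  entry 7 12 3 12 (-10) [::
    fam 1 3 (2,(1,0),1) (2,(-3,0),-3) (2,(3,6),-1) false true true;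
    fam 2 3 (2,(-7,-12),-1) (2,(-5,-12),3) (2,(-10,-18),1) false false false;
    fam (-2) 1 (0,(-3,-6),1) (0,(-4,-6),-1) (1,(12,9),3) true false false;
    fam 0 2 (0,(-2,-5),1) (0,(-5,-7),-1) (1,(1,0),3) true false false;
    fam (-1) 2 (0,(0,-3),1) (0,(-7,-9),-1) (1,(7,6),3) true false false;
    fam (-2) 1 (0,(0,-1),1) (0,(-7,-11),-1) (1,(5,0),3) true false false;
    fam 1 0 (0,(2,3),0) (0,(-1,-3),0) (0,(-6,-9),0) true true true;
    fam 1 0 (0,(1,0),0) (0,(6,12),0) (1,(-1,3),0) true false false;
    fam 1 0 (0,(-2,0),0) (0,(-5,-12),0) (1,(-2,-3),0) true false false;
    fam 1 0 (0,(-1,-1),0) (0,(-6,-11),0) (1,(4,12),0) true false false;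
    fam 1 0 (0,(3,5),0) (0,(4,7),0) (1,(1,6),0) true false false;
    fam 1 0 (0,(4,5),0) (0,(3,7),0) (1,(-4,-6),0) true false false;
    fam 1 0 (0,(5,5),0) (0,(2,7),0) (1,(2,0),0) true false false;
    fam 1 0 (2,(-4,-6),0) (2,(0,0),0) (0,(5,9),0) true false false;
    fam 1 0 (0,(-7,-12),0) (1,(6,9),0) (2,(-6,-12),0) false false false];
  entry 8 12 2 0 0 [::
    fam 1 3 (2,(1,12),1) (2,(-3,12),-3) (2,(3,18),-1) false true true;
    fam 2 3 (2,(-9,0),-1) (2,(-7,0),3) (2,(-12,-6),1) false false false;
    fam 1 1 (0,(-2,-6),1) (0,(-7,-6),-1) (1,(6,-3),3) true false false;
    fam (-2) 2 (0,(0,-5),1) (0,(-9,-7),-1) (1,(2,-12),3) true false false;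
    fam 1 2 (0,(-1,-3),1) (0,(-8,-9),-1) (1,(-1,-6),3) true false false;
    fam 0 1 (0,(0,-1),1) (0,(-9,-11),-1) (1,(4,-12),3) true false false;
    fam 1 0 (2,(0,12),0) (2,(4,18),0) (2,(-8,0),0) true true false;
    fam 1 0 (0,(-2,-3),0) (0,(7,9),0) (1,(2,0),0) true false false;
    fam 1 0 (0,(1,5),0) (0,(8,7),0) (1,(1,-12),0) true false false;
    fam 1 0 (0,(-3,-6),0) (0,(-6,-6),0) (1,(-2,-15),0) true false false;
    fam 1 0 (0,(4,6),0) (0,(5,6),0) (1,(-4,-6),0) true false false];
  entry 9 12 3 12 0 [::
    fam 2 3 (2,(1,0),1) (2,(-3,0),-3) (2,(4,6),-1) false false false;
    fam 2 3 (2,(-7,-12),-1) (2,(-5,-12),3) (2,(-11,-18),1) false true true;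
    fam (-1) 1 (0,(-2,-6),1) (0,(-7,-6),-1) (1,(12,9),3) true false false;
    fam (-2) 2 (0,(0,-5),1) (0,(-9,-7),-1) (1,(4,0),3) true false false;
    fam 1 2 (0,(-1,-3),1) (0,(-8,-9),-1) (1,(1,6),3) true false false;
    fam 0 1 (0,(0,-1),1) (0,(-9,-11),-1) (1,(2,0),3) true false false;
    fam 1 0 (0,(4,6),0) (0,(-5,-6),0) (0,(9,12),0) true false true;
    fam 1 0 (0,(-1,-5),0) (0,(-8,-7),0) (1,(12,18),0) true false false;
    fam 1 0 (0,(-2,-5),0) (0,(-7,-7),0) (1,(0,0),0) true false false;
    fam 1 0 (0,(3,5),0) (0,(6,7),0) (1,(4,12),0) true false false;
    fam 1 0 (0,(3,6),0) (0,(6,6),0) (1,(-2,6),0) true false false;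
    fam 1 0 (2,(5,6),0) (2,(-13,-18),0) (0,(-2,-3),0) true false false;
    fam 1 0 (0,(7,9),0) (1,(9,9),0) (2,(-9,-15),0) false false false];
  entry 10 12 1 0 (-6) [::
    fam 2 3 (2,(20,12),1) (2,(16,12),-3) (2,(23,18),-1) false false false;
    fam 2 3 (2,(10,0),-1) (2,(12,0),3) (2,(6,-6),1) false true true;
    fam 0 1 (0,(-5,-6),1) (0,(-6,-6),-1) (1,(-10,-3),3) true false false;
    fam 1 2 (0,(-4,-5),1) (0,(-7,-7),-1) (1,(-17,-12),3) true false false;
    fam 1 2 (0,(-2,-3),1) (0,(-9,-9),-1) (1,(-11,-6),3) true false false;
    fam 0 1 (0,(-1,-1),1) (0,(-10,-11),-1) (1,(-18,-12),3) true false false;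
    fam 1 0 (2,(24,18),0) (2,(19,12),0) (2,(14,6),0) false true false;
    fam 1 0 (0,(1,0),0) (0,(10,12),0) (1,(-8,3),0) true false false;
    fam 1 0 (0,(3,3),0) (0,(-8,-9),0) (1,(-4,6),0) true false false;
    fam 1 0 (0,(-5,-5),0) (0,(-6,-7),0) (1,(-5,6),0) true false false];
  entry 11 12 2 12 0 [::
    fam 2 3 (2,(1,0),1) (2,(-3,0),-3) (2,(5,6),-1) false true true;
    fam 3 3 (2,(-12,-12),-1) (2,(-10,-12),3) (2,(-17,-18),1) false false false;
    fam 0 1 (0,(-4,-6),1) (0,(-7,-6),-1) (1,(12,9),3) true false false;
    fam (-1) 2 (0,(-2,-5),1) (0,(-9,-7),-1) (1,(8,0),3) true false false;
    fam 0 2 (0,(-2,-3),1) (0,(-9,-9),-1) (1,(8,6),3) true false false;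
    fam 0 1 (0,(-1,-1),1) (0,(-10,-11),-1) (1,(1,0),3) true false false;
    fam 1 0 (0,(5,6),0) (0,(6,6),0) (0,(11,12),0) true true true;
    fam 1 0 (0,(1,0),0) (0,(10,12),0) (1,(9,9),0) true false false;
    fam 1 0 (0,(2,1),0) (0,(9,11),0) (1,(5,6),0) true false false;
    fam 1 0 (0,(3,5),0) (0,(8,7),0) (1,(8,12),0) true false false;
    fam 1 0 (0,(-4,-5),0) (0,(-7,-7),0) (1,(2,0),0) true false false;
    fam 1 0 (2,(-11,-12),0) (2,(0,0),0) (0,(-8,-9),0) true false false;
    fam 1 0 (0,(3,3),0) (1,(1,3),0) (2,(3,3),0) false false false];
  entry 2 0 0 0 (-2) [::
    fam 1 0 (1,(-1,0),0) (0,(1,0),0) (0,(2,0),0) false false false;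
    fam 1 0 (2,(-1,0),0) (2,(0,0),0) (2,(2,0),0) true false true];
  entry 4 0 0 0 4 [::
    fam 1 0 (0,(2,0),0) (2,(-3,0),0) (0,(4,0),0) false false false;
    fam 1 0 (2,(-4,0),0) (2,(1,0),0) (2,(2,0),0) false false false;
    fam 1 0 (1,(-3,0),0) (1,(-4,0),0) (1,(2,0),0) true true true;
    fam 1 0 (0,(3,0),0) (0,(1,0),0) (2,(-1,0),0) true false false];
  entry 5 0 0 0 2 [::
    fam 1 0 (0,(4,0),0) (1,(5,0),0) (2,(1,0),0) false false false;
    fam 1 0 (1,(1,0),0) (0,(-5,0),0) (1,(0,0),0) false false false;
    fam 1 0 (0,(3,0),0) (0,(-1,0),0) (0,(2,0),0) false false true;
    fam 1 0 (2,(5,0),0) (2,(3,0),0) (2,(-3,0),0) false false true;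
    fam 1 0 (1,(2,0),0) (1,(-2,0),0) (1,(-4,0),0) true true true];
  entry 6 0 0 0 (-2) [::
    fam 1 0 (1,(2,0),0) (1,(0,0),0) (0,(4,0),0) false false false;
    fam 1 0 (0,(2,0),0) (1,(3,0),0) (1,(-1,0),0) false false false;
    fam 1 0 (2,(5,0),0) (0,(-3,0),0) (2,(-6,0),0) false false true;
    fam 1 0 (0,(6,0),0) (0,(-1,0),0) (0,(5,0),0) false true false;
    fam 1 0 (1,(4,0),0) (1,(-4,0),0) (1,(1,0),0) false true false;
    fam 1 0 (2,(3,0),0) (2,(6,0),0) (2,(2,0),0) true true true];
  entry 7 0 0 0 0 [::
    fam 1 0 (2,(2,0),0) (1,(6,0),0) (1,(-5,0),0) false false false;
    fam 1 0 (1,(-4,0),0) (0,(5,0),0) (2,(0,0),0) false false false;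
    fam 1 0 (0,(1,0),0) (0,(4,0),0) (1,(1,0),0) false false false;
    fam 1 0 (1,(4,0),0) (1,(-3,0),0) (1,(-1,0),0) false false false;
    fam 1 0 (1,(7,0),0) (1,(5,0),0) (1,(-7,0),0) true true false;
    fam 1 0 (1,(-6,0),0) (1,(3,0),0) (1,(2,0),0) false true true;
    fam 1 0 (0,(3,0),0) (0,(7,0),0) (0,(-2,0),0) true true true];
  entry 8 0 0 0 4 [::
    fam 1 0 (2,(0,0),1) (2,(-4,0),-3) (2,(2,0),-1) false false false;
    fam 2 0 (2,(-10,0),-1) (2,(-8,0),3) (2,(-13,0),1) true false false;
    fam 2 0 (0,(-4,0),1) (0,(-5,0),-1) (1,(3,0),3) true false false;
    fam 1 0 (2,(-1,0),0) (2,(3,0),0) (2,(-9,0),0) true true false;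
    fam 1 0 (0,(1,0),0) (0,(8,0),0) (1,(2,0),0) true false false;
    fam 1 0 (0,(2,0),0) (0,(-7,0),0) (1,(-1,0),0) true false false];
  entry 9 0 0 0 2 [::
    fam 2 0 (2,(1,0),1) (2,(-3,0),-3) (2,(4,0),-1) false false false;
    fam 2 0 (2,(-10,0),-1) (2,(-8,0),3) (2,(-14,0),1) false true true;
    fam 1 0 (0,(4,0),0) (0,(-5,0),0) (0,(9,0),0) true false true;
    fam 1 0 (0,(1,0),0) (0,(8,0),0) (1,(2,0),0) true false false;
    fam 1 0 (0,(3,0),0) (0,(6,0),0) (1,(9,0),0) true false false;
    fam 1 0 (2,(-1,0),0) (2,(0,0),0) (0,(7,0),0) true false false;
    fam 1 0 (0,(2,0),0) (1,(7,0),0) (2,(-12,0),0) false false false];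
  entry 10 0 0 0 (-2) [::
    fam 1 0 (0,(8,0),0) (1,(8,0),0) (1,(-9,0),0) false false false;
    fam 1 0 (1,(6,0),0) (1,(9,0),0) (1,(0,0),0) false false false;
    fam 1 0 (0,(6,0),0) (0,(1,0),0) (0,(3,0),0) false false true;
    fam 1 0 (1,(10,0),0) (2,(-1,0),0) (1,(-10,0),0) false false false;
    fam 1 0 (2,(4,0),0) (0,(10,0),0) (2,(5,0),0) false false true;
    fam 1 0 (1,(7,0),0) (1,(-3,0),0) (1,(-7,0),0) false true false;
    fam 1 0 (0,(7,0),0) (2,(8,0),0) (0,(-5,0),0) false false true;
    fam 1 0 (2,(2,0),0) (1,(-1,0),0) (2,(-3,0),0) false false true;
    fam 1 0 (0,(2,0),0) (0,(-4,0),0) (0,(9,0),0) true false true;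
    fam 1 0 (2,(6,0),0) (2,(-4,0),0) (2,(-2,0),0) true true true];
  entry 11 0 0 0 8 [::
    fam 2 0 (2,(1,0),1) (2,(-3,0),-3) (2,(5,0),-1) false true true;
    fam 3 0 (2,(-12,0),-1) (2,(-10,0),3) (2,(-17,0),1) false false false;
    fam 2 0 (0,(-2,0),1) (0,(-9,0),-1) (1,(2,0),3) true false false;
    fam 1 0 (0,(5,0),0) (0,(6,0),0) (0,(11,0),0) true true true;
    fam 1 0 (0,(-4,0),0) (0,(-7,0),0) (1,(9,0),0) true false false;
    fam 1 0 (2,(-11,0),0) (2,(0,0),0) (0,(8,0),0) true false false;
    fam 1 0 (0,(-3,0),0) (1,(-3,0),0) (2,(-8,0),0) false false false];
  entry 13 0 0 0 6 [::
    fam 3 0 (2,(1,0),1) (2,(-3,0),-3) (2,(6,0),-1) false false false;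
    fam 3 0 (2,(-13,0),-1) (2,(-11,0),3) (2,(-19,0),1) false true true;
    fam 2 0 (0,(-5,0),1) (0,(-8,0),-1) (1,(4,0),3) true false false;
    fam 1 0 (0,(6,0),0) (0,(-7,0),0) (0,(13,0),0) true false true;
    fam 1 0 (0,(1,0),0) (0,(12,0),0) (1,(0,0),0) true false false;
    fam 1 0 (0,(-2,0),0) (0,(-11,0),0) (1,(12,0),0) true false false;
    fam 1 0 (2,(-2,0),0) (2,(-1,0),0) (0,(3,0),0) true false false;
    fam 1 0 (0,(10,0),0) (1,(16,0),0) (2,(-10,0),0) false false false];
  entry 14 0 0 0 (-2) [::
    fam 3 0 (2,(8,0),1) (2,(4,0),-3) (2,(13,0),-1) false false false;
    fam 3 0 (2,(-8,0),-1) (2,(-6,0),3) (2,(-14,0),1) false true true;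
    fam 3 0 (0,(-7,0),1) (0,(-8,0),-1) (1,(-5,0),3) true false false;
    fam 1 0 (0,(-3,0),1) (0,(-12,0),-1) (1,(7,0),3) true false false;
    fam 1 0 (2,(-11,0),0) (2,(-4,0),0) (2,(3,0),0) false true false;
    fam 1 0 (0,(1,0),0) (0,(14,0),0) (1,(-14,0),0) true false false;
    fam 1 0 (0,(2,0),0) (0,(13,0),0) (1,(-7,0),0) true false false;
    fam 1 0 (0,(-4,0),0) (0,(11,0),0) (1,(-6,0),0) true false false];
  entry 15 0 0 0 6 [::
    fam 3 0 (2,(1,0),1) (2,(-3,0),-3) (2,(7,0),-1) false true true;
    fam 4 0 (2,(-15,0),-1) (2,(-13,0),3) (2,(-22,0),1) false false false;
    fam 3 0 (0,(-3,0),1) (0,(-12,0),-1) (1,(5,0),3) true false false;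
    fam 1 0 (0,(7,0),0) (0,(8,0),0) (0,(15,0),0) true true true;
    fam 1 0 (0,(-5,0),0) (0,(-10,0),0) (1,(-8,0),0) true false false;
    fam 1 0 (0,(-6,0),0) (0,(-9,0),0) (1,(0,0),0) true false false;
    fam 1 0 (2,(4,0),0) (2,(-12,0),0) (0,(-11,0),0) true false false;
    fam 1 0 (0,(4,0),0) (1,(2,0),0) (2,(-14,0),0) false false false];
  entry 17 0 0 0 12 [::
    fam 4 0 (2,(1,0),1) (2,(-3,0),-3) (2,(8,0),-1) false false false;
    fam 4 0 (2,(-16,0),-1) (2,(-14,0),3) (2,(-24,0),1) false true true;
    fam 2 0 (0,(-6,0),1) (0,(-11,0),-1) (1,(1,0),3) true false false;
    fam 2 0 (0,(-3,0),1) (0,(-14,0),-1) (1,(10,0),3) true false false;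
    fam 1 0 (0,(8,0),0) (0,(-9,0),0) (0,(17,0),0) true false true;
    fam 1 0 (0,(1,0),0) (0,(16,0),0) (1,(2,0),0) true false false;
    fam 1 0 (0,(-7,0),0) (0,(-10,0),0) (1,(20,0),0) true false false;
    fam 1 0 (2,(9,0),0) (2,(-25,0),0) (0,(13,0),0) true false false;
    fam 1 0 (0,(4,0),0) (1,(0,0),0) (2,(-15,0),0) false false false];
  entry 18 0 0 0 26 [::
    fam 4 0 (2,(-9,0),1) (2,(-13,0),-3) (2,(-2,0),-1) false false false;
    fam 4 0 (2,(-28,0),-1) (2,(-26,0),3) (2,(-36,0),1) false true true;
    fam 3 0 (0,(-7,0),1) (0,(-12,0),-1) (1,(12,0),3) true false false;
    fam 2 0 (0,(-3,0),1) (0,(-16,0),-1) (1,(11,0),3) true false false;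
    fam 1 0 (2,(-1,0),0) (2,(-10,0),0) (2,(-27,0),0) false true true;
    fam 1 0 (0,(-1,0),0) (0,(18,0),0) (1,(24,0),0) false false false;
    fam 1 0 (0,(-4,0),0) (0,(15,0),0) (1,(25,0),0) true false false;
    fam 1 0 (0,(-8,0),0) (0,(-11,0),0) (1,(37,0),0) true false false;
    fam 1 0 (0,(-9,0),0) (0,(-10,0),0) (1,(32,0),0) true false false];
  entry 19 0 0 0 8 [::
    fam 4 0 (2,(1,0),1) (2,(-3,0),-3) (2,(9,0),-1) false true true;
    fam 5 0 (2,(-19,0),-1) (2,(-17,0),3) (2,(-28,0),1) false false false;
    fam 4 0 (0,(-9,0),1) (0,(-10,0),-1) (1,(4,0),3) true false false;
    fam 1 0 (0,(5,0),0) (0,(-4,0),0) (0,(15,0),0) true true true;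
    fam 1 0 (0,(1,0),0) (0,(18,0),0) (1,(2,0),0) true false false;
    fam 1 0 (0,(-2,0),0) (0,(-17,0),0) (1,(18,0),0) true false false;
    fam 1 0 (0,(-3,0),0) (0,(-16,0),0) (1,(0,0),0) true false false;
    fam 1 0 (2,(-1,0),0) (2,(10,0),0) (0,(-19,0),0) true false false;
    fam 1 0 (0,(-14,0),0) (1,(-5,0),0) (2,(-16,0),0) false false false];
  entry 20 0 0 0 12 [::
    fam 4 0 (2,(9,0),1) (2,(5,0),-3) (2,(17,0),-1) false true true;
    fam 5 0 (2,(-13,0),-1) (2,(-11,0),3) (2,(-22,0),1) false false false;
    fam 2 0 (0,(-10,0),1) (0,(-11,0),-1) (1,(7,0),3) true false false;
    fam 3 0 (0,(-8,0),1) (0,(-13,0),-1) (1,(-6,0),3) true false false;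
    fam 3 0 (0,(-4,0),1) (0,(-17,0),-1) (1,(6,0),3) true false false;
    fam 1 0 (2,(-3,0),0) (2,(7,0),0) (2,(18,0),0) true true false;
    fam 1 0 (0,(-1,0),0) (0,(-20,0),0) (1,(-4,0),0) true false false;
    fam 1 0 (0,(5,0),0) (0,(-16,0),0) (1,(-8,0),0) true false false];
  entry 21 0 0 0 14 [::
    fam 5 0 (2,(1,0),1) (2,(-3,0),-3) (2,(10,0),-1) false false false;
    fam 5 0 (2,(-21,0),-1) (2,(-19,0),3) (2,(-31,0),1) false true true;
    fam 4 0 (0,(-9,0),1) (0,(-12,0),-1) (1,(2,0),3) true false false;
    fam 2 0 (0,(-4,0),1) (0,(-17,0),-1) (1,(17,0),3) true false false;
    fam 1 0 (0,(10,0),0) (0,(-11,0),0) (0,(21,0),0) true false true;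
    fam 1 0 (0,(1,0),0) (0,(20,0),0) (1,(26,0),0) true false false;
    fam 1 0 (0,(-2,0),0) (0,(-19,0),0) (1,(14,0),0) true false false;
    fam 1 0 (2,(-1,0),0) (2,(0,0),0) (0,(-16,0),0) true false false;
    fam 1 0 (0,(5,0),0) (1,(4,0),0) (2,(11,0),0) false false false];
  entry 23 0 0 0 14 [::
    fam 5 0 (2,(1,0),1) (2,(-3,0),-3) (2,(11,0),-1) false true true;
    fam 6 0 (2,(-22,0),-1) (2,(-20,0),3) (2,(-33,0),1) false false false;
    fam 3 0 (0,(-9,0),1) (0,(-14,0),-1) (1,(1,0),3) true false false;
    fam 3 0 (0,(-5,0),1) (0,(-18,0),-1) (1,(13,0),3) true false false;
    fam 1 0 (0,(11,0),0) (0,(12,0),0) (0,(23,0),0) true true true;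
    fam 1 0 (0,(-1,0),0) (0,(-22,0),0) (1,(2,0),0) true false false;
    fam 1 0 (0,(2,0),0) (0,(21,0),0) (1,(18,0),0) true false false;
    fam 1 0 (0,(-10,0),0) (0,(-13,0),0) (1,(-12,0),0) true false false;
    fam 1 0 (2,(-10,0),0) (2,(-34,0),0) (0,(-6,0),0) true false false;
    fam 1 0 (0,(-17,0),0) (1,(-6,0),0) (2,(0,0),0) false false false];
  entry 25 0 0 0 18 [::
    fam 6 0 (2,(1,0),1) (2,(-3,0),-3) (2,(12,0),-1) false false false;
    fam 6 0 (2,(-24,0),-1) (2,(-22,0),3) (2,(-36,0),1) false true true;
    fam 4 0 (0,(-10,0),1) (0,(-15,0),-1) (1,(2,0),3) true false false;
    fam 3 0 (0,(-5,0),1) (0,(-20,0),-1) (1,(17,0),3) true false false;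
    fam 1 0 (0,(12,0),0) (0,(-13,0),0) (0,(25,0),0) true false true;
    fam 1 0 (0,(-1,0),0) (0,(-24,0),0) (1,(4,0),0) true false false;
    fam 1 0 (0,(2,0),0) (0,(23,0),0) (1,(21,0),0) true false false;
    fam 1 0 (0,(-11,0),0) (0,(-14,0),0) (1,(37,0),0) true false false;
    fam 1 0 (2,(-1,0),0) (2,(0,0),0) (0,(-19,0),0) true false false;
    fam 1 0 (0,(-6,0),0) (1,(30,0),0) (2,(-14,0),0) false false false];
  entry 31 0 0 0 18 [::
    fam 7 0 (2,(1,0),1) (2,(-3,0),-3) (2,(15,0),-1) false true true;
    fam 8 0 (2,(-31,0),-1) (2,(-29,0),3) (2,(-46,0),1) false false false;
    fam 4 0 (0,(-12,0),1) (0,(-19,0),-1) (1,(1,0),3) true false false;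
    fam 3 0 (0,(-6,0),1) (0,(-25,0),-1) (1,(19,0),3) true false false;
    fam 2 0 (0,(-3,0),1) (0,(-28,0),-1) (1,(2,0),3) true false false;
    fam 1 0 (0,(8,0),0) (0,(-7,0),0) (0,(-24,0),0) true true true;
    fam 1 0 (0,(1,0),0) (0,(30,0),0) (1,(13,0),0) true false false;
    fam 1 0 (0,(-13,0),0) (0,(-18,0),0) (1,(-16,0),0) true false false;
    fam 1 0 (0,(14,0),0) (0,(17,0),0) (1,(28,0),0) true false false;
    fam 1 0 (0,(15,0),0) (0,(16,0),0) (1,(24,0),0) true false false;
    fam 1 0 (2,(-16,0),0) (2,(0,0),0) (0,(23,0),0) true false false;
    fam 1 0 (0,(31,0),0) (1,(27,0),0) (2,(-30,0),0) false false false];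
  entry 33 0 0 0 28 [::
    fam 8 0 (2,(1,0),1) (2,(-3,0),-3) (2,(16,0),-1) false false false;
    fam 8 0 (2,(-31,0),-1) (2,(-29,0),3) (2,(-47,0),1) false true true;
    fam 4 0 (0,(-12,0),1) (0,(-21,0),-1) (1,(1,0),3) true false false;
    fam 5 0 (0,(-7,0),1) (0,(-26,0),-1) (1,(16,0),3) true false false;
    fam 2 0 (0,(-2,0),1) (0,(-31,0),-1) (1,(2,0),3) true false false;
    fam 1 0 (0,(16,0),0) (0,(-17,0),0) (0,(33,0),0) true false true;
    fam 1 0 (0,(-13,0),0) (0,(-20,0),0) (1,(48,0),0) true false false;
    fam 1 0 (0,(-14,0),0) (0,(-19,0),0) (1,(30,0),0) true false false;
    fam 1 0 (0,(15,0),0) (0,(18,0),0) (1,(13,0),0) true false false;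
    fam 1 0 (2,(17,0),0) (2,(-49,0),0) (0,(25,0),0) true false false;
    fam 1 0 (0,(-8,0),0) (1,(27,0),0) (2,(0,0),0) false false false]].

Lemma starter_table_ok : all entry_ok starter_table.
Proof. by vm_compute. Qed.

End StarterTable.

From mathcomp Require Import all_boot all_algebra.
From mathcomp Require Import zify ring ssrZ.
Import GRing.Theory.
Delimit Scope nat_scope with N.
Delimit Scope Z_scope with Z.

(** * The lower bound *)

Lemma count_sum_nth (T : Type) (x0 : T) (p : pred T) (s : seq T) :
  count p s = \sum_(i < size s) p (nth x0 s i).
Proof. by rewrite -sum1_count big_mkcond (big_nth x0) big_mkord; apply: eq_bigr => i _; case: (p _). Qed.

Lemma sum_mem_card (T : finType) (X B : {set T}) :
  B \subset X -> \sum_(z in X) (z \in B : nat) = #|B|.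
Proof.
move=> BX; rewrite -big_mkcondr /= sum1_card; apply: eq_card => z.
by rewrite unfold_in /=; apply: andb_idl; apply: (subsetP BX).
Qed.

Lemma sum_bool_le1 (I : finType) (p : pred I) :
  (forall i j, p i -> p j -> i = j) -> \sum_i (p i : nat) <= 1.
Proof.
move=> p_uniq; rewrite -big_mkcond sum1_card.
by apply/card_le1_eqP => i j; rewrite !unfold_in => pi pj; exact: p_uniq pj pi.
Qed.

Section LowerBound.
Variables (T : finType) (v : nat) (X Y : {set T}) (A : seq {set T}) (phi : 'I_(size A) -> T).
Hypotheses (bibd : is_BIBD v 3 2 X A) (nesting : strong_nesting X Y phi).
Local Notation B i := (nth set0 A i).

Let B_sub i : (i < size A)%N -> B i \subset X.
Proof. by case: bibd => _ bl _ /(mem_nth set0)/bl[]. Qed.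

Let card_B i : (i < size A)%N -> #|B i| = 3.
Proof. by case: bibd => _ bl _ /(mem_nth set0)/bl[]. Qed.

Let card_X : #|X| = v. Proof. by case: bibd. Qed.

Let sum_B (i : 'I_(size A)) : \sum_(z in X) (z \in B i : nat) = 3.
Proof. by rewrite sum_mem_card ?card_B ?B_sub. Qed.

Let B_X (i : 'I_(size A)) x : x \in B i -> x \in X.
Proof. exact: (subsetP (B_sub (ltn_ord i))). Qed.

(** Count in two ways the incidences of the other points with the blocks through [x]: twice v-1
    because every pair is covered twice, and twice the replication number because such a block has
    two further points. *)
Lemma replication x : x \in X -> \sum_(i < size A) (x \in B i : nat) = v.-1.
Proof.
move=> xX; case: (bibd) => _ _ cov.
have: \sum_(y in X :\ x) \sum_(i < size A) ((x \in B i) && (y \in B i) : nat) = v.-1 * 2.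
  rewrite (eq_bigr (fun=> 2)); last first.
    move=> y; rewrite in_setD1 => /andP[yx yX].
    by rewrite -(cov x y) // ?(count_sum_nth set0) // eq_sym.
  by rewrite sum_nat_const -card_X [in RHS](cardsD1 x) xX.
rewrite exchange_big /= (eq_bigr (fun i : 'I_(size A) => (x \in B i) * 2)).
  by rewrite -big_distrl /= => /eqP; rewrite eqn_pmul2r // => /eqP.
move=> i _; case: (boolP (x \in B i)) => /= xB; last by rewrite big1.
have := sum_B i; rewrite (big_setD1 x) //= xB.
by case.
Qed.

Lemma number_of_blocks : 3 * size A = v * v.-1.
Proof.
have <- : \sum_(x in X) \sum_(i < size A) (x \in B i : nat) = v * v.-1.
  rewrite (eq_bigr (fun=> v.-1)) ?sum_nat_const ?card_X // => x; exact: replication.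
rewrite exchange_big /= (eq_bigr (fun=> 3)) => [|i _]; last exact: sum_B.
by rewrite sum_nat_const card_ord mulnC.
Qed.

Let W := #|Y :\: X|.
Let fibre y := \sum_(i < size A) (phi i == y : nat).

Let nest_pair (i j : 'I_(size A)) x y :
  x \in B i -> y \in B j -> [set x; phi i] = [set y; phi j] -> i = j /\ x = y.
Proof. by case: nesting => _ _ _; apply. Qed.

Let sum_fibre y (Z : {set T}) : (forall i, phi i = y -> B i \subset Z) ->
  \sum_(z in Z) \sum_(i < size A) ((phi i == y) && (z \in B i) : nat) = 3 * fibre y.
Proof.
move=> BZ; rewrite exchange_big /= big_distrr /=; apply: eq_bigr => i _.
case: (eqVneq (phi i) y) => [iy|_] /=; last by rewrite big1.
by rewrite muln1 sum_mem_card ?card_B ?BZ.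
Qed.

Lemma fibre_outside y : y \in Y :\: X -> 3 * fibre y <= v.
Proof.
rewrite inE => /andP[yX _]; rewrite -(sum_fibre (Z := X)); last by move=> i _; apply: B_sub.
rewrite -card_X -[#|X|]muln1 -sum_nat_const; apply: leq_sum => z zX.
apply: sum_bool_le1 => i j /andP[/eqP iy zi] /andP[/eqP jy zj].
by case: (nest_pair zi zj) => //; rewrite iy jy.
Qed.

Lemma fibre_inside x : x \in X -> 3 * fibre x <= W.
Proof.
move=> xX.
have phi_notin (i : 'I_(size A)) : phi i \notin B i by case: nesting.
(* Each pair {x,z} with z in X is used at most once, either by a block on z nested at [x] or by a
   block on [x] nested at z. Both uses give the same unordered pair, so they exclude each other. *)
have inner : 3 * fibre x + \sum_(i < size A) ((x \in B i) && (phi i \in X) : nat) <= v.-1.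
  rewrite -(sum_fibre (Z := X :\ x)); last first.
    move=> i ix; apply/subsetP => z zB; rewrite in_setD1 (B_X zB) andbT.
    by apply: contraNneq (phi_notin i) => zx; rewrite ix -zx.
  have -> : \sum_(i < size A) ((x \in B i) && (phi i \in X) : nat) =
      \sum_(z in X :\ x) \sum_(i < size A) ((x \in B i) && (phi i == z) : nat).
    rewrite exchange_big /=; apply: eq_bigr => i _.
    case: (boolP (x \in B i)) => xB /=; last by rewrite big1.
    have xphi : phi i != x by apply: contraNneq (phi_notin i) => ->.
    case: (boolP (phi i \in X)) => phiX.
      rewrite (big_setD1 (phi i)) /= ?in_setD1 ?xphi // eqxx big1 // => z.
      by rewrite in_setD1 eq_sym => /andP[/negPf->].
    by rewrite big1 // => z; rewrite in_setD1 => /andP[_ zX]; case: eqP phiX => // ->; rewrite zX.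
  rewrite -big_split /= -card_X (cardsD1 x) xX -[#|_|]muln1 -sum_nat_const.
  apply: leq_sum => z; rewrite in_setD1 => /andP[zx zX].
  have le1 := sum_bool_le1 (p := fun i : 'I_(size A) => (phi i == x) && (z \in B i)) _.
  have le1' := sum_bool_le1 (p := fun i : 'I_(size A) => (x \in B i) && (phi i == z)) _.
  have [|/existsPn no1] := boolP [exists i, (phi i == x) && (z \in B i)]; last first.
    rewrite big1 => [|i _]; last by rewrite (negPf (no1 i)).
    rewrite add0n; apply: le1' => i j /andP[xi /eqP iz] /andP[xj /eqP jz].
    by case: (nest_pair xi xj) => //; rewrite iz jz.
  move=> /existsP[i /andP[/eqP ix zi]].
  rewrite [X in _ + X]big1 => [|j _].
    rewrite addn0; apply: le1 => j k /andP[/eqP jx zj] /andP[/eqP kx zk].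
    by case: (nest_pair zj zk) => //; rewrite jx kx.
  apply/eqP; rewrite eqb0; apply/negP => /andP[xj /eqP jz].
  case: (nest_pair zi xj); first by rewrite ix jz setUC.
  by move=> _ zx'; rewrite zx' eqxx in zx.
(* Blocks through [x] nested outside X have distinct nests, for otherwise a pair {x,z} would repeat.
   Together with [inner] and the replication number this bounds the fibre. *)
have outer : \sum_(i < size A) ((x \in B i) && (phi i \notin X) : nat) <= W.
  have -> : \sum_(i < size A) ((x \in B i) && (phi i \notin X) : nat) =
      \sum_(z in Y :\: X) \sum_(i < size A) ((x \in B i) && (phi i == z) : nat).
    rewrite exchange_big /=; apply: eq_bigr => i _.
    case: (boolP (x \in B i)) => xB /=; last by rewrite big1.
    have phiY : phi i \in Y by case: nesting.
    case: (boolP (phi i \in X)) => phiX /=.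
      by rewrite big1 // => z; rewrite in_setD => /andP[zX _]; case: eqP zX => // <-; rewrite phiX.
    rewrite (big_setD1 (phi i)) /= ?in_setD ?phiX // eqxx big1 // => z.
    by rewrite in_setD1 eq_sym => /andP[/negPf->].
  rewrite -[W]muln1 -sum_nat_const; apply: leq_sum => z _.
  apply: sum_bool_le1 => i j /andP[xi /eqP iz] /andP[xj /eqP jz].
  by case: (nest_pair xi xj) => //; rewrite iz jz.
have := replication xX.
have -> : \sum_(i < size A) (x \in B i : nat) =
    \sum_(i < size A) ((x \in B i) && (phi i \in X) : nat) +
    \sum_(i < size A) ((x \in B i) && (phi i \notin X) : nat).
  by rewrite -big_split /=; apply: eq_bigr => i _; case: (x \in B i); case: (phi i \in X).
by lia.
Qed.

Lemma blocks_le : size A <= v * (W %/ 3) + W * (v %/ 3).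
Proof.
have -> : size A = \sum_(y in Y) fibre y.
  rewrite exchange_big /= (eq_bigr (fun=> 1)) ?sum1_card ?card_ord // => i _.
  rewrite (big_setD1 (phi i)) /=; last by case: nesting.
  by rewrite eqxx big1 // => z; rewrite in_setD1 eq_sym => /andP[/negPf->].
have XY : X \subset Y by case: nesting.
rewrite (big_setID X) /= (setIidPr XY); apply: leq_add.
  rewrite -card_X -sum_nat_const; apply: leq_sum => x xX.
  by rewrite leq_divRL // mulnC; apply: fibre_inside.
rewrite -sum_nat_const; apply: leq_sum => y yXY.
by rewrite leq_divRL // mulnC; apply: fibre_outside.
Qed.

Lemma strong_nesting_card : v %% 6 = 3 -> (3 * v + 1) %/ 2 <= #|Y|.
Proof.
move=> v6; have := blocks_le; have := number_of_blocks.
have XY : X \subset Y by case: nesting.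
have : #|Y| = v + W by rewrite -(cardsID X Y) (setIidPr XY) card_X.
move: (size A) (#|Y|) => b y; rewrite /W; move: #|_ :\: _| => w -> b_eq b_le.
pose t := v %/ 6; have v_eq : v = 6 * t + 3 by rewrite /t; lia.
case: (leqP (3 * t + 2) w) => [|w_small]; first by lia.
have w3 : w %/ 3 <= t by lia.
have v3 : v %/ 3 = 2 * t + 1 by lia.
(* With w at most 3t+1 the bound becomes (6t+3)t + (3t+1)(2t+1) = (2t+1)(6t+1), while the number of
   blocks is (2t+1)(6t+2). *)
exfalso; move: b_le; rewrite v3 => b_le.
have : b <= v * t + (3 * t + 1) * (2 * t + 1).
  by apply: leq_trans b_le _; apply: leq_add; rewrite ?leq_mul2l ?leq_mul2r; lia.
have : v.-1 = 6 * t + 2 by lia.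
by move: b_eq; rewrite v_eq => b_eq v1; rewrite v1 in b_eq; nia.
Qed.
End LowerBound.

(** * Designs given by indexed or listed blocks *)

Lemma card_sum_bool (I : finType) (p : pred I) : #|[set i | p i]| = \sum_i (p i : nat).
Proof. by rewrite -sum1_card big_mkcond; apply: eq_bigr => i _; rewrite inE; case: (p i). Qed.

(** Indexing the blocks by a finite type keeps repeated blocks apart; enumerating [I] then turns an
    index into a position in the list. *)
Lemma indexed_nested_design (T I : finType) (v : nat) (X Y : {set T})
    (B : I -> {set T}) (f : I -> T) :
  #|X| = v -> (forall i, B i \subset X) -> (forall i, #|B i| = 3) ->
  (forall x y, x \in X -> y \in X -> x != y ->
    #|[set i | (x \in B i) && (y \in B i)]| = 2) ->
  X \subset Y -> (forall i, f i \in Y) -> (forall i, f i \notin B i) ->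
  (forall i j x y, x \in B i -> y \in B j ->
    [set x; f i] = [set y; f j] -> i = j /\ x = y) ->
  exists (A : seq {set T}) (phi : 'I_(size A) -> T),
    is_BIBD v 3 2 X A /\ strong_nesting X Y phi.
Proof.
move=> card_X B_sub card_B cov XY f_in f_notin f_inj.
pose A := [seq B i | i <- enum I].
have size_A : size A = #|I| by rewrite size_map -cardE.
pose idx (k : 'I_(size A)) : I := enum_val (cast_ord size_A k).
have nth_A (k : 'I_(size A)) : nth set0 A k = B (idx k).
  have x0 := idx k; rewrite (nth_map x0) /idx; last by rewrite -cardE -size_A.
  by rewrite (enum_val_nth x0).
exists A, (fun k => f (idx k)); split; split=> //.
- by move=> _ /mapP[i _ ->]; split.
- move=> x y xX yX xy; rewrite count_map -(cov x y xX yX xy) cardE -size_filter.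
  by congr size; rewrite enumT /enum_mem -enumT; apply: eq_filter => i /=; rewrite inE.
- by move=> k; rewrite nth_A.
move=> i j x y; rewrite !nth_A => xi yj eq_ij.
have [ij xy] := f_inj _ _ _ _ xi yj eq_ij; split=> //.
by apply: (@cast_ord_inj _ _ size_A); apply: enum_val_inj.
Qed.

Lemma set2_eq (T : finType) (x y x' y' : T) :
  [set x; y] = [set x'; y'] -> x = x' /\ y = y' \/ x = y' /\ y = x'.
Proof.
move=> eqs; have: x \in [set x'; y'] by rewrite -eqs set21.
have: y \in [set x'; y'] by rewrite -eqs set22.
have: y' \in [set x; y] by rewrite eqs set22.
have: x' \in [set x; y] by rewrite eqs set21.
by do 4![case/set2P=> ?]; subst; auto.
Qed.

Lemma inl_eqE (A B : eqType) (x y : A) : (inl x == inl y :> A + B) = (x == y).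
Proof. by []. Qed.

(** The bookkeeping for [pair_in_arms]: nine ordered pairs of entries of a triple, the three
    diagonal ones being zero, against the six terms in the order of [differences]. *)
Lemma six_terms (ab ba ac ca bc cb : nat) :
  0 + (ba + ca) + (ab + (0 + cb) + (ac + (bc + 0))) = ab + (ba + (bc + (cb + (ac + (ca + 0))))).
Proof. by lia. Qed.

Lemma gt0_addn_le1 (a b u w e : nat) :
  0 < a -> 0 < b -> a <= u -> b <= w -> u + (w + e) <= 1 -> False.
Proof. by lia. Qed.

(** * Checking explicit block lists *)

Definition nested_block : Type := seq nat * nat.

(** An unordered pair is coded by its minimum and maximum, so that distinctness of pairs becomes
    [uniq]. *)
Definition nest_pairs (b : nested_block) : seq (nat * nat) :=
  [seq (minn x b.2, maxn x b.2) | x <- b.1].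

Definition listed_design_ok (v w : nat) (L : seq nested_block) : bool :=
  [&& v <= w, all (fun b => [&& size b.1 == 3, uniq b.1, all (fun x => x < v) b.1,
                     b.2 < w & b.2 \notin b.1]) L,
      all (fun x => all (fun y => (x == y) ||
        (count (fun b : nested_block => (x \in b.1) && (y \in b.1)) L == 2)) (iota 0 v)) (iota 0 v) &
      uniq (flatten [seq nest_pairs b | b <- L])].

Lemma uniq_flatten_nth (I : Type) (T : eqType) (F : I -> seq T) (L : seq I) i0 i j x :
  uniq (flatten [seq F b | b <- L]) -> i < size L -> j < size L ->
  x \in F (nth i0 L i) -> x \in F (nth i0 L j) -> i = j.
Proof.
have mem k s : k < size s -> x \in F (nth i0 s k) -> x \in flatten [seq F b | b <- s].
  elim: s k => [|b s IHs] [|k] //= ks xF; rewrite mem_cat ?xF //.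
  by rewrite (IHs k) ?orbT.
elim: L i j => [|b L IHL] [|i] [|j] //=; rewrite cat_uniq => /and3P[_ /hasPn disj uL] iL jL xi xj.
- by have /negP := disj _ (mem _ _ jL xj).
- by have /negP := disj _ (mem _ _ iL xi).
- by rewrite (IHL i j).
Qed.

(** X consists of the numbers below [v] and Y is all of ['I_w.+1]; the successor makes this type
    inhabited, as [inord] requires. *)
Lemma listed_design v w L : listed_design_ok v w.+1 L ->
  exists (T : finType) (X Y : {set T}) (A : seq {set T}) (phi : 'I_(size A) -> T),
    [/\ is_BIBD v 3 2 X A, strong_nesting X Y phi & #|Y| = w.+1].
Proof.
case/and4P=> vw /allP blocks /allP pairs nests.
pose b0 : nested_block := ([::], 0); pose b (i : 'I_(size L)) := nth b0 L i.
pose B i := [set x : 'I_w.+1 | val x \in (b i).1].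
pose f i : 'I_w.+1 := inord (b i).2.
have bP i := blocks (b i) (mem_nth b0 (ltn_ord i)).
have fE i : f i = (b i).2 :> nat by rewrite inordK //; case/and5P: (bP i).
have f_notin i : f i \notin B i by rewrite inE /= fE; case/and5P: (bP i).
have [||||||||A [phi [bibd nesting]]] := @indexed_nested_design 'I_w.+1 'I_(size L) v
    [set x : 'I_w.+1 | x < v] setT B f.
- rewrite -sum1_card (eq_bigl (fun x : 'I_w.+1 => x < v)) => [|x]; last by rewrite inE.
  by rewrite (big_ord_narrow (F := fun=> 1) vw) sum1_card card_ord.
- move=> i; apply/subsetP => x; rewrite !inE.
  by have /and5P[_ _ /allP bv _ _] := bP i => /bv.
- move=> i; have /and5P[/eqP sz u /allP bv _ _] := bP i.
  have -> : B i = [set x in [seq inord y : 'I_w.+1 | y <- (b i).1]].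
    apply/setP => x; rewrite !inE; apply/idP/mapP => [xb|[y yb ->]].
      by exists (val x); rewrite ?inord_val.
    by rewrite /= inordK //; apply: leq_trans (bv _ yb) vw.
  have inord_uniq : uniq [seq inord y : 'I_w.+1 | y <- (b i).1].
    rewrite map_inj_in_uniq // => x y /bv xv /bv yv /(congr1 val) /=.
    by rewrite !inordK //; [apply: leq_trans yv vw | apply: leq_trans xv vw].
  by rewrite cardsE (card_uniqP inord_uniq) size_map.
- move=> x y; rewrite !inE => xv yv xy.
  have := pairs (val x); rewrite mem_iota add0n => /(_ xv)/allP/(_ (val y)).
  rewrite mem_iota add0n => /(_ yv).
  rewrite -[_ == _ :> nat]/(x == y) (negPf xy) /= => /eqP <-.
  rewrite (count_sum_nth b0) card_sum_bool; apply: eq_bigr => i _.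
  by rewrite !inE.
- exact: subsetT.
- by [].
- exact: f_notin.
- move=> i j x y xi yj eq_ij.
  have code k (z : 'I_w.+1) : z \in B k -> (minn z (f k), maxn z (f k)) \in nest_pairs (b k).
    by rewrite inE => zb; rewrite fE; apply/mapP; exists (val z).
  have x_f : x != f i by apply: contraNneq (f_notin i) => <-.
  have y_f : y != f j by apply: contraNneq (f_notin j) => <-.
  have [[xy ff]|[xf fy]] : (x = y /\ f i = f j) \/ (x = f j /\ f i = y).
    exact: set2_eq.
  - split=> //; apply: val_inj; apply: (uniq_flatten_nth (i0 := b0) nests (ltn_ord i) (ltn_ord j)).
      exact: code xi.
    by rewrite xy ff; exact: code yj.
  (* In the crossed case the codes still agree, so [i = j]; then [x] is the nest of its own block,
     which is excluded. *)
  - have ij : i = j.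
      apply: val_inj; apply: (uniq_flatten_nth (i0 := b0) nests (ltn_ord i) (ltn_ord j)).
        exact: code xi.
      by rewrite xf fy minnC maxnC; exact: code yj.
    by move: x_f; rewrite xf ij eqxx.
by exists 'I_w.+1, [set x : 'I_w.+1 | x < v], setT, A, phi; split=> //; rewrite cardsT card_ord.
Qed.

(** Each of the points 0 to 8 receives one block, and each of the five further points 9 to 13
    receives three disjoint blocks partitioning X. *)
Definition design9 : seq nested_block := [seq ([:: b.1.1.1; b.1.1.2; b.1.2], b.2) | b <- [::
  (0,5,7,1); (1,3,8,2); (2,4,6,0); (0,3,6,8); (1,4,7,6); (2,5,8,7); (0,1,5,3); (2,4,6,5);
  (3,7,8,4); (0,1,2,9); (3,4,5,9); (6,7,8,9); (0,4,8,10); (1,5,6,10); (2,3,7,10); (4,5,8,11);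
  (1,3,6,11); (0,2,7,11); (5,6,7,12); (0,3,4,12); (1,2,8,12); (2,3,5,13); (0,6,8,13); (1,4,7,13)]].

Lemma design9_ok : listed_design_ok 9 14 design9.
Proof. by vm_compute. Qed.

Definition point21 (x l : nat) : nat := x %% 7 + 7 * l.
(* Nine base blocks over Z_7 with their nests, and eleven rows (d, e, further point). *)
Definition design21 : seq nested_block :=
  flatten [seq [seq ([seq point21 (p.1 + x) p.2 | p <- b.1], point21 (b.2.1 + x) b.2.2) | x <- iota 0 7]
    | b <- [:: ([:: (0,0); (1,0); (5,0)], (1,2)); ([:: (0,0); (1,0); (5,0)], (1,1));
               ([:: (0,1); (1,1); (3,1)], (6,2)); ([:: (0,1); (1,1); (3,1)], (6,1));
               ([:: (0,2); (1,2); (3,2)], (6,1)); ([:: (0,2); (1,2); (3,2)], (6,2));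
               ([:: (0,0); (0,1); (6,2)], (2,0)); ([:: (0,0); (1,1); (1,2)], (6,0));
               ([:: (0,0); (0,1); (1,2)], (3,0))]] ++
  flatten [seq [seq ([:: point21 x 0; point21 (x + r.1.1) 1; point21 (x + r.1.1 + r.1.2) 2], r.2)
      | x <- iota 0 7]
    | r <- [:: (1,1,21); (2,0,22); (2,3,23); (3,2,24); (3,4,25); (4,2,26); (4,3,27); (5,5,28);
               (5,6,29); (6,4,30); (6,5,31)]].

Lemma design21_ok : listed_design_ok 21 32 design21.
Proof. by vm_compute. Qed.

Local Open Scope ring_scope.

(** * Differences of two bijections *)

Lemma surj_inj (T : finType) (f : T -> T) :
  (forall y, exists x, f x = y) -> injective f.
Proof.
move=> f_surj; apply/injectiveP; rewrite /injectiveb /dinjectiveb.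
apply/card_uniqP; rewrite size_map -cardE; apply/eqP.
rewrite eqn_leq max_card andTb.
apply: subset_leq_card; apply/subsetP => y _.
by have [x <-] := f_surj y; apply: codom_f.
Qed.

(** The exchange step of Hall's theorem: an amount [d] of the difference [c - a] moves from [j] to
    [i] while both maps stay bijective, which allows the differences to be corrected one point at a
    time. *)
Lemma difference_exchange (G : finZmodType) (a c : G -> G) (i j d : G) :
  injective a -> injective c -> i != j ->
  exists a' c' : G -> G, [/\ injective a', injective c' &
    forall x, c' x - a' x = c x - a x + d *+ (x == i) - d *+ (x == j)].
Proof.
move=> a_inj c_inj ij; pose D := c i + d + a j.
(* The chain j, f j, f (f j), ... runs until it meets i or j; on it [a] and [c] trade places. *)
pose f u := invF c_inj (D - a u).
have cf u : c (f u) = D - a u by rewrite f_invF.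
have f_inj : injective f by move=> u w /(congr1 c); rewrite !cf => /addrI/oppr_inj/a_inj.
(* [f] is injective on a finite set, so the orbit of [j] returns at least to [j]; the chain stops at
   the first hit. *)
have ex_k : exists k, iter k.+1 f j \in [:: i; j].
  exists (fingraph.order f j).-1; rewrite prednK ?order_gt0 // iter_order //.
  by rewrite !inE eqxx orbT.
pose k := ex_minn ex_k.
have kP : iter k.+1 f j \in [:: i; j] by rewrite /k; case: ex_minnP.
have k_min m : (m < k)%N -> iter m.+1 f j \notin [:: i; j].
  rewrite /k; case: ex_minnP => k' _ kmin mk'.
  by apply/negP => /kmin; rewrite leqNgt mk'.
pose O := [seq iter m f j | m <- iota 1 k].
pose l := iter k f j.
have OP x : reflect (exists2 m, (0 < m <= k)%N & x = iter m f j) (x \in O).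
  apply: (iffP mapP) => [[m mk ->]|[m mk ->]]; exists m => //; move: mk;
    by rewrite mem_iota add1n ltnS.
have ijO x : x \in O -> x \notin [:: i; j].
  by move=> /OP[[|m] // mk ->]; apply: k_min.
have iO : i \notin O by apply/negP => /ijO; rewrite !inE eqxx.
have jO : j \notin O by apply/negP => /ijO; rewrite !inE eqxx orbT.
have predO x : x \in O -> exists2 u, u \in j :: O & c x = D - a u.
  move=> /OP[[|m] // /ltnW mk ->]; exists (iter m f j); last by rewrite /= cf.
  rewrite inE; case: m mk => [|m] mk; first by rewrite eqxx.
  by apply/orP; right; apply/OP; exists m.+1.
have succO u : u \in j :: O -> u = l \/ exists2 w, w \in O & c w = D - a u.
  have step m : (m <= k)%N -> iter m f j = l \/
      exists2 w, w \in O & c w = D - a (iter m f j).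
    rewrite leq_eqVlt => /orP[/eqP->|mk]; [by left | right].
    by exists (iter m.+1 f j); [apply/OP; exists m.+1 | rewrite /= cf].
  by rewrite inE => /orP[/eqP->|/OP[m /andP[_ mk] ->]]; [apply: (step 0%N) | apply: step].
have lO : l \in j :: O.
  rewrite inE /l; case: (posnP k) => [->|k0]; first by rewrite eqxx.
  by apply/orP; right; apply/OP; exists k; rewrite ?k0 /=.
(* On the chain the new difference (D - a x) - (D - c x) is the old one. The choice of [D] makes the
   change at [i] equal to [d], and [c'] at [j] is chosen to make the change there equal to [-d]. *)
pose a' x := if x \in O then D - c x else if x == j then a l else a x.
pose c' x := if x \in O then D - a x else
  if x == i then D - a j else if x == j then a l + (c j - a j - d) else c x.
have ji : (j == i) = false by rewrite eq_sym (negPf ij).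
(* As [c (f l) = D - a l], this value is [c j] if the chain ends at [i] and [c i] if it ends at [j]:
   exactly the value of [c] that is still missing. *)
have cj : a l + (c j - a j - d) = c i + c j - (D - a l).
  rewrite /D -[c i + d + _]addrA opprB opprD [c i + c j]addrC [a l + (- c i - _)]addrCA.
  rewrite [RHS]addrA addrK [RHS]addrCA; congr (_ + _).
  by rewrite [d + a j]addrC opprD addrA.
exists a', c'; split.
- apply: surj_inj => y; pose x := invF a_inj y.
  have ax : a x = y by rewrite f_invF.
  have [xO|xNO] := boolP (x \in j :: O).
    have [xl|[w wO cw]] := succO _ xO.
      by exists j; rewrite /a' (negPf jO) eqxx -xl.
    by exists w; rewrite /a' wO cw opprB addrC subrK.
  by move: xNO; rewrite inE negb_or => /andP[xj xO]; exists x; rewrite /a' (negPf xO) (negPf xj).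
- apply: surj_inj => y; pose x := invF c_inj y.
  have cx : c x = y by rewrite f_invF.
  have Dal : exists2 z, c' z = D - a l & z \in i :: O.
    move: lO; rewrite inE => /orP[/eqP lj|lO].
      by exists i; rewrite ?inE ?eqxx // /c' (negPf iO) eqxx lj.
    by exists l; rewrite ?inE ?lO ?orbT // /c' lO.
  have c'j : c' j = c i + c j - (D - a l).
    by rewrite /c' (negPf jO) ji eqxx cj.
  have cfl : c (f l) = D - a l := cf l.
  have [xO|xNO] := boolP (x \in O).
    have [u uO cu] := predO _ xO; move: uO; rewrite inE => /orP[/eqP uj|uO].
      by exists i; rewrite /c' (negPf iO) eqxx -cx cu uj.
    by exists u; rewrite /c' uO -cx cu.
  have [z zE _] := Dal.
  move: kP; rewrite /= -/l !inE => /orP[/eqP fl|/eqP fl]; rewrite fl in cfl.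
    have [xi|xi] := eqVneq x i; first by exists z; rewrite zE -cfl -cx xi.
    have [xj|xj] := eqVneq x j.
      by exists j; rewrite c'j -cfl -cx xj addrAC subrr add0r.
    by exists x; rewrite /c' (negPf xNO) (negPf xi) (negPf xj).
  have [xi|xi] := eqVneq x i; first by exists j; rewrite c'j -cfl -cx xi addrK.
  have [xj|xj] := eqVneq x j; first by exists z; rewrite zE -cfl -cx xj.
  by exists x; rewrite /c' (negPf xNO) (negPf xi) (negPf xj).
- move=> x; rewrite /a' /c'; have [xO|xNO] := boolP (x \in O).
    have := ijO _ xO; rewrite !inE negb_or => /andP[/negPf-> /negPf->].
    by rewrite !mulr0n addr0 subr0 opprB addrC addrA subrK.
  have [->|xi] := eqVneq x i.
    by rewrite (negPf ij) mulr0n mulr1n subr0 /D addrK addrAC.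
  have [->|xj] := eqVneq x j.
    by rewrite mulr0n mulr1n addr0 addrC addKr.
  by rewrite !mulr0n addr0 subr0.
Qed.

(** Hall's theorem, by induction from [a = c = id]. In [bs s] the prescribed differences hold on [s]
    and the point 0 absorbs the deficit; once [s] contains all nonzero elements, the zero sum makes
    the value at 0 correct as well. *)
Theorem difference_of_bijections (G : finZmodType) (b : G -> G) :
  \sum_x b x = 0 ->
  exists a c : G -> G, [/\ injective a, injective c & forall x, c x - a x = b x].
Proof.
move=> b_sum.
pose bs (s : seq G) x :=
  if x \in s then b x else (- \sum_(y <- s) b y) *+ (x == 0).
have main s : uniq s -> 0 \notin s -> exists a c : G -> G,
    [/\ injective a, injective c & forall x, c x - a x = bs s x].
  elim: s => [_ _|y s IHs /= /andP[ys s_uniq]].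
    exists id, id; split=> // x.
    by rewrite subrr /bs big_nil oppr0 mul0rn.
  rewrite inE negb_or => /andP[y0 s0].
  have [a [c [a_inj c_inj ac]]] := IHs s_uniq s0.
  have y0' : y != 0 by rewrite eq_sym.
  have [a' [c' [a'_inj c'_inj ac']]] := difference_exchange (b y) a_inj c_inj y0'.
  exists a', c'; split=> // x; rewrite ac' ac /bs inE.
  have [->|xy] := eqVneq x y.
    by rewrite (negPf ys) (negPf y0') !mulr0n add0r subr0 mulr1n.
  rewrite /=; case: ifP => xs.
    have [x0|_] := eqVneq x 0; first by rewrite -x0 xs in s0.
    by rewrite !mulr0n addr0 subr0.
  by rewrite big_cons mulr0n addr0 -mulrnBl opprD addrC.
have [||a [c [a_inj c_inj ac]]] := main [seq x <- enum G | x != 0].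
- exact: filter_uniq (enum_uniq _).
- by rewrite mem_filter eqxx.
exists a, c; split=> // x; rewrite ac /bs mem_filter mem_enum andbT.
have [->|//] := eqVneq x 0; rewrite /= mulr1n big_filter big_enum_cond /=.
by move/eqP: b_sum; rewrite (bigD1 0) //= addr_eq0 => /eqP->.
Qed.

(** * From starters to nested designs *)

Lemma sum_translates (I : finType) (V : zmodType) (f : I -> V) (f' : V -> I) (x y u w : V) :
  cancel f f' -> cancel f' f ->
  (\sum_(g : I) ((x == f g + u)%R && (y == f g + w)%R : nat) = (w - u == y - x)%R)%N.
Proof.
move=> fK f'K; rewrite (bigD1 (f' (x - u))) //= f'K subrK eqxx /= big1 ?addn0 => [|g gxu].
  by rewrite -(addrA x) (addrC x) -subr_eq (addrC (- u)) eq_sym.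
by rewrite -subr_eq -[x - u == f g](inj_eq (can_inj f'K)) fK eq_sym (negPf gxu).
Qed.

Section Starter.
Variables (t : nat) (H : finZmodType).
Hypothesis card_H : #|H| = (2 * t + 1)%N.
Local Notation G := (H * 'Z_3)%type.

(** A translate nested at g creates the pairs {g, g+a}. Up to translation an unordered pair is a
    difference up to sign, hence both signs of every entry. *)
Definition nest_elements (N : seq (G * G * G)) : seq G :=
  flatten [seq [:: p.1.1; p.1.2; p.2; - p.1.1; - p.1.2; - p.2] | p <- N].

Definition differences (N : seq (G * G * G)) : seq G :=
  flatten [seq [:: p.1.1 - p.1.2; p.1.2 - p.1.1; p.1.2 - p.2; p.2 - p.1.2;
                   p.1.1 - p.2; p.2 - p.1.1] | p <- N].

Definition mixed_differences (N : seq (G * G * G)) : seq H :=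
  [seq d.1 | d <- differences N & d.2 == 1].

Definition starter (N : seq (G * G * G)) :=
  [/\ size N = t, uniq (0 :: nest_elements N),
      forall h, h != 0 -> count_mem (h, 0) (differences N) = 2%N,
      uniq (mixed_differences N) & size (mixed_differences N) = t
      /\ \sum_(h <- mixed_differences N) h = 0].

(* The differences 0 -> 1, 1 -> 2 and 2 -> 0 between consecutive levels of the rows [r i]. *)
Definition completes (M : seq H) (r : 'I_(3 * t + 2) -> H * H) :=
  forall h : H, [/\ #|[set i | (r i).1 == h]| = (2 - (h \in M))%N,
    #|[set i | (r i).2 == h]| = (2 - (h \in M))%N &
    #|[set i | - ((r i).1 + (r i).2) == h]| = (2 - (h \in M))%N].

(** With C the complement of M, the t+1 rows (x,x) contribute C to the first two sequences and D =
    -2C to the third. The n rows (a x, - c x) contribute all of H to the first two and the list [L]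
    to the third. *)
Lemma completion (M : seq H) : injective (fun x : H => x + x) ->
  uniq M -> size M = t -> \sum_(h <- M) h = 0 -> exists r, completes M r.
Proof.
move=> dbl_inj M_uniq size_M sum_M.
pose C := [seq h <- enum H | h \notin M].
pose D := [seq - (h + h) | h <- C].
(* [L] is what the third sequence lacks: together with D it covers H once and C once more. It has n
   terms and sum zero, so Hall's theorem applies to it. *)
pose L := C ++ [seq h <- enum H | h \notin D].
have C_uniq : uniq C by apply: filter_uniq; apply: enum_uniq.
have D_inj : injective (fun h : H => - (h + h)) by move=> x y /oppr_inj/dbl_inj.
have D_uniq : uniq D by rewrite map_inj_uniq.
have countC h : count_mem h C = (h \notin M).
  by rewrite count_uniq_mem // mem_filter mem_enum andbT.
have split_enum (S : seq H) : uniq S ->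
    perm_eq (enum H) (S ++ [seq h <- enum H | h \notin S]).
  move=> S_uniq; apply: uniq_perm; rewrite ?enum_uniq //.
    rewrite cat_uniq S_uniq filter_uniq ?enum_uniq // andbT /=.
    by apply/hasPn => h; rewrite mem_filter => /andP[].
  by move=> h; rewrite mem_enum mem_cat mem_filter mem_enum andbT orbN.
have size_C : size C = t.+1.
  have /perm_size := split_enum M M_uniq; rewrite size_cat -cardE card_H size_M.
  by rewrite -/C; move: (size C) => k; lia.
(* Negation permutes H, so the sum is its own opposite, and doubling is injective. *)
have sumH : \sum_(h : H) h = 0.
  apply: dbl_inj; rewrite addr0 -[X in X + _]opprK -sumrN.
  by rewrite [in X in - X](reindex_inj (@oppr_inj H)) /= (eq_bigr id) ?addNr // => h _; rewrite opprK.
have sumE (S : seq H) : uniq S ->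
    \sum_(h <- S) h + \sum_(h <- [seq h <- enum H | h \notin S]) h = 0.
  by move=> S_uniq; rewrite -big_cat -(perm_big _ (split_enum S S_uniq)) big_enum.
have sumC : \sum_(h <- C) h = 0 by have := sumE M M_uniq; rewrite sum_M add0r.
have sumD : \sum_(h <- D) h = 0 by rewrite big_map sumrN big_split /= sumC addr0 oppr0.
have size_L : size L = #|H|.
  have /perm_size := split_enum D D_uniq; rewrite size_cat -cardE size_map size_C.
  by rewrite /L size_cat size_C => ->.
have sumL : \sum_(h <- L) h = 0.
  by rewrite big_cat /= sumC add0r; have := sumE D D_uniq; rewrite sumD add0r.
pose b (x : H) := nth 0 L (enum_rank x).
have mapb : [seq b x | x <- enum H] = L.
  apply: (@eq_from_nth _ 0) => [|i]; rewrite size_map -cardE ?size_L // => iH.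
  by rewrite (nth_map 0) -?cardE // /b -[i]/(val (Ordinal iH)) -enum_val_nth enum_valK.
have [|a [c [a_inj c_inj ac]]] := @difference_of_bijections H b.
  by rewrite -[RHS]sumL -[in RHS]mapb big_map big_enum.
pose R := [seq (x, x) | x <- C] ++ [seq (a x, - c x) | x <- enum H].
have size_R : size R = (3 * t + 2)%N.
  by rewrite size_cat !size_map -enumT -cardE card_H size_C; lia.
exists (fun i => nth (0, 0) R i) => h.
have cnt (p : pred (H * H)) :
    #|[set i : 'I_(3 * t + 2) | p (nth (0, 0) R i)]| = count p R.
  by rewrite card_sum_bool (count_sum_nth (0, 0)) size_R.
have cnt_inj (f : H -> H) : injective f -> count (fun x => f x == h) (enum H) = 1%N.
  move=> f_inj; rewrite -(count_map f (pred1 h)) count_uniq_mem; last first.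
    by rewrite map_inj_uniq // -?enumT ?enum_uniq.
  suff -> : h \in map f (enum H) by [].
  by apply/mapP; exists (invF f_inj h); rewrite ?mem_enum ?f_invF.
split; [apply: (etrans (cnt (fun p => p.1 == h))) | apply: (etrans (cnt (fun p => p.2 == h)))
       | apply: (etrans (cnt (fun p => - (p.1 + p.2) == h)))];
  rewrite count_cat [X in (X + _)%N]count_map [X in (_ + X)%N]count_map.
- by apply: (etrans (congr2 addn (countC h) (cnt_inj a a_inj))); case: (h \in M).
- have negc_inj : injective (fun x => - c x) by move=> x y /oppr_inj/c_inj.
  by apply: (etrans (congr2 addn (countC h) (cnt_inj _ negc_inj))); case: (h \in M).
have countD : count_mem h D = (h \in D) by rewrite count_uniq_mem.
have countL : count (fun x => - (a x - c x) == h) (enum H) = (~~ (h \in M) + ~~ (h \in D))%N.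
  have -> : count (fun x => - (a x - c x) == h) (enum H) = count_mem h L.
    by rewrite -mapb [RHS]count_map; apply: eq_count => x /=; rewrite -ac opprB.
  rewrite /L count_cat countC; congr (_ + _)%N.
  by rewrite count_uniq_mem; [rewrite mem_filter mem_enum andbT | apply: filter_uniq; apply: enum_uniq].
have -> : count (preim (fun x => (x, x)) (fun p => - (p.1 + p.2) == h)) C = count_mem h D.
  by rewrite count_map.
apply: (etrans (congr2 addn countD countL)).
by case: (h \in M); case: (h \in D).
Qed.

(* Index [inl (i, x)]: the x-th block of the i-th further point; index [inr (k, g)]: the translate
   by g of the k-th base triple. *)
Definition block (r : 'I_(3 * t + 2) -> H * H) (N : seq (G * G * G))
   (i : 'I_(3 * t + 2) * H + 'I_t * G) : {set G + 'I_(3 * t + 2)} :=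
  match i with
  | inl (i, x) => [set inl (x, 0); inl (x + (r i).1, 1); inl (x + (r i).1 + (r i).2, 2%:R)]
  | inr (k, g) => let p := nth (0, 0, 0) N k in
      [set inl (g + p.1.1); inl (g + p.1.2); inl (g + p.2)]
  end.

Definition nest_point (i : 'I_(3 * t + 2) * H + 'I_t * G) : G + 'I_(3 * t + 2) :=
  match i with inl (i, _) => inr i | inr (_, g) => inl g end.

(** * Developing a starter into a nested design *)

Section Development.
Variables (N : seq (G * G * G)) (r : 'I_(3 * t + 2) -> H * H).
Hypotheses (N_starter : starter N) (r_completes : completes (mixed_differences N) r).

Let arm (k : 'I_t) := let p := nth (0, 0, 0) N k in [:: p.1.1; p.1.2; p.2].

Let size_N : size N = t. Proof. by case: N_starter. Qed.

Let sum_flatten (F : G * G * G -> seq G) x :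
  count_mem x (flatten [seq F p | p <- N]) =
    (\sum_(k < t) count_mem x (F (nth (0, 0, 0)%R N k)))%N.
Proof.
rewrite count_flatten -map_comp sumnE big_map (big_nth (0, 0, 0)) size_N big_mkord.
by apply: eq_bigr.
Qed.

(** The distinctness of the elements plus or minus a, put as one inequality from which the next four
    facts are read off; the element 0, for instance, would be counted once for each sign. *)
Let arm_count (x : G) : (\sum_(k < t) (count_mem x (arm k) + count_mem (- x)%R (arm k)) <= 1)%N.
Proof.
case: N_starter => _ /= /andP[_ N_uniq] _ _ _.
have <- : count_mem x (nest_elements N) =
    (\sum_(k < t) (count_mem x (arm k) + count_mem (- x)%R (arm k)))%N.
  rewrite sum_flatten; apply: eq_bigr => k _ /=.
  by rewrite !addn0 !eqr_oppLR !addnA.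
by rewrite count_uniq_mem // leq_b1.
Qed.

Let arm0 k : 0 \notin arm k.
Proof.
apply/negP; rewrite -has_pred1 has_count => k0.
by have := arm_count 0; rewrite (bigD1 k) // oppr0; move: k0; case: (count _ (arm k)) => // n;
  rewrite addSn addnS.
Qed.

Let arm_inj x k k' : x \in arm k -> x \in arm k' -> k = k'.
Proof.
rewrite -!has_pred1 !has_count => xk xk'; apply/eqP/negPn/negP => kk'.
have := arm_count x; rewrite (bigD1 k) // (bigD1 k') 1?eq_sym //.
exact: (gt0_addn_le1 xk xk' (leq_addr _ _) (leq_addr _ _)).
Qed.

Let arm_opp x k k' : x \in arm k -> - x \notin arm k'.
Proof.
rewrite -!has_pred1 !has_count => xk; apply/negP => xk'.
have := arm_count x; rewrite (bigD1 k) //; have [kk'|kk'] := eqVneq k k'.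
  rewrite -kk' in xk'; case: (count _ (arm k)) xk => // n _; case: (count _ (arm k)) xk' => // n' _.
  by rewrite addSn addnS.
rewrite (bigD1 k') 1?eq_sym //.
exact: (gt0_addn_le1 xk xk' (leq_addr _ _) (leq_addl _ _)).
Qed.

Let arm_mem x k : (x \in arm k : nat) = count_mem x (arm k).
Proof.
rewrite -has_pred1 has_count; have := arm_count x; rewrite (bigD1 k) //=.
rewrite -[(_ + (_ + (_ + 0)))%N]/(count_mem x (arm k)).
by case: (count_mem x (arm k)) => [|[|n]] //; rewrite -addnA.
Qed.

Let in_row_block i x h l : (inl (h, l) \in block r N (inl (i, x))) =
  (h == x + [:: 0; (r i).1; (r i).1 + (r i).2]`_l).
Proof.
rewrite !inE !inl_eqE !xpair_eqE.
case: l => [[|[|[|l]]] l3] //=; rewrite ?andbT ?andbF ?orbF ?addr0 ?addrA //.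
Qed.

Let in_arm_block k g (x : G) : (inl x \in block r N (inr (k, g))) = (x - g \in arm k).
Proof.
by rewrite !inE !inl_eqE -!orbA ![g + _]addrC -!subr_eq.
Qed.

Let sum_translates_G (x y u w : G) :
  (\sum_(g : G) ((x == g + u)%R && (y == g + w)%R : nat) = (w - u == y - x)%R)%N.
Proof. exact: (@sum_translates _ G id id x y u w (fun=> erefl) (fun=> erefl)). Qed.

Let sum_translates_H (x y u w : H) :
  (\sum_(g : H) ((x == g + u)%R && (y == g + w)%R : nat) = (w - u == y - x)%R)%N.
Proof. exact: (@sum_translates _ H id id x y u w (fun=> erefl) (fun=> erefl)). Qed.

Let pair_in_arms (x y : G) : x != y ->
  (\sum_(p : 'I_t * G) ((inl x \in block r N (inr p)) && (inl y \in block r N (inr p)) : nat) =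
   count_mem (y - x)%R (differences N))%N.
Proof.
move=> xy; pose F k g : nat := (inl x \in block r N (inr (k, g))) && (inl y \in block r N (inr (k, g))).
rewrite (eq_bigr (fun p => F p.1 p.2)) => [|[k g] _ //]; rewrite -(pair_bigA _ F) {}/F.
rewrite sum_flatten; apply: eq_bigr => k _.
(* Membership in a triple is a sum of three indicators, so the product expands into nine sums over
   translates, each equal to 1 or 0 according as a difference of entries is y - x. The diagonal ones
   vanish since [x != y]. *)
under eq_bigr => g _ do rewrite -mulnb !in_arm_block !arm_mem /= !addn0 !mulnDl !mulnDr !mulnb
  ![_ == x - g]eq_sym ![_ == y - g]eq_sym !subr_eq ![_ + g]addrC.
rewrite !big_split /= !sum_translates_G !subrr.
have -> : (0 == y - x) = false by rewrite eq_sym subr_eq0 eq_sym (negPf xy).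
exact: six_terms.
Qed.

Let pair_in_rows (x y : G) (off := fun i : 'I_(3 * t + 2) => [:: 0; (r i).1; (r i).1 + (r i).2]) :
  (\sum_(p : 'I_(3 * t + 2) * H) ((inl x \in block r N (inl p)) && (inl y \in block r N (inl p)) : nat) =
   \sum_i (((off i)`_(y.2) - (off i)`_(x.2))%R == (y.1 - x.1)%R))%N.
Proof.
pose F i h : nat := (inl x \in block r N (inl (i, h))) && (inl y \in block r N (inl (i, h))).
rewrite (eq_bigr (fun p => F p.1 p.2)) => [|[i h] _ //]; rewrite -(pair_bigA _ F) {}/F.
apply: eq_bigr => i _; rewrite -sum_translates_H; apply: eq_bigr => h _.
by rewrite [x]surjective_pairing [y]surjective_pairing !in_row_block.
Qed.

Let count_mixed (h : H) : count_mem (h, 1) (differences N) = (h \in mixed_differences N).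
Proof.
case: N_starter => _ _ _ mixed_uniq _.
rewrite -(count_uniq_mem h mixed_uniq) count_map count_filter; apply: eq_count => d /=.
by rewrite -pair_eqE.
Qed.

(* A difference of levels 2 is the opposite of a difference of levels 1. *)
Let pair_count (x y : G) : x != y -> y.2 - x.2 != 2%:R ->
  #|[set i | (inl x \in block r N i) && (inl y \in block r N i)]| = 2.
Proof.
move=> xy; rewrite card_sum_bool big_sumType /= pair_in_rows pair_in_arms //.
have -> : y - x = (y.1 - x.1, y.2 - x.2) by case: (x) (y) => [? ?] [? ?].
have same : y.2 = x.2 -> y.1 - x.1 != 0.
  by move=> e2; rewrite subr_eq0; apply: contraNneq xy => e1;
    rewrite [x]surjective_pairing [y]surjective_pairing e1 e2.
have pure : y.2 = x.2 -> count_mem (y.1 - x.1, 0) (differences N) = 2.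
  by case: N_starter => _ _ pureN _ _ /same; apply: pureN.
have [r1 r2 r3] := r_completes (y.1 - x.1).
case: x y {xy} same pure r1 r2 r3 => [x l] [y l'] /=.
have Z3 (z : 'Z_3) : [\/ z = 0, z = 1 | z = 2%:R].
  by case: z => [[|[|[|//]]] z3]; [constructor 1 | constructor 2 | constructor 3]; apply: val_inj.
have n01 : (0 : 'Z_3) - 1 = 2%:R by apply: val_inj.
have n12 : (1 : 'Z_3) - 2%:R = 2%:R by apply: val_inj.
have n20 : (2%:R : 'Z_3) - 0 = 2%:R by apply: val_inj.
have n21 : (2%:R : 'Z_3) - 1 = 1 by apply: val_inj.
have n02 : (0 : 'Z_3) - 2%:R = 1 by apply: val_inj.
have v1 : nat_of_ord (1 : 'Z_3) = 1%N by [].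
have v2 : nat_of_ord (2%:R : 'Z_3) = 2%N by [].
have sub2 (b : bool) : (2 - b + b)%N = 2 by case: b.
move=> same pure r1 r2 r3 lev.
case: (eqVneq l' l) => [ll'|l'l].
  rewrite big1 => [|i _]; last by rewrite ll' subrr eq_sym (negPf (same ll')).
  by rewrite ll' subrr; apply: pure.
(* The three steps 0 to 1, 1 to 2 and 2 to 0 use the three counts of [completes]. The rows cover the
   pair 2 - [h in M] times, and the base triples supply the missing [h in M]. *)
have [l'E c_l] : l' - l = 1 /\ (\sum_(i < 3 * t + 2) (([:: 0; (r i).1; (r i).1 + (r i).2]`_l' -
        [:: 0; (r i).1; (r i).1 + (r i).2]`_l)%R == (y - x)%R) =
        2 - ((y - x)%R \in mixed_differences N))%N.
  move: lev l'l; case: (Z3 l) => ->; case: (Z3 l') => ->;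
    rewrite ?n01 ?n12 ?n20 ?n21 ?n02 ?subr0 ?eqxx //= ?v1 ?v2 => _ _; split=> //.
  - by rewrite -r1 card_sum_bool; apply: eq_bigr => i _; rewrite subr0.
  - by rewrite -r2 card_sum_bool; apply: eq_bigr => i _; rewrite /= addrC addKr.
  - by rewrite -r3 card_sum_bool; apply: eq_bigr => i _; rewrite /= sub0r.
by rewrite c_l l'E count_mixed.
Qed.

Lemma development_covers_twice (x y : G) : x != y ->
  #|[set i | (inl x \in block r N i) && (inl y \in block r N i)]| = 2.
Proof.
move=> xy; case: (eqVneq (y.2 - x.2) 2%:R) => [yx2|]; last exact: pair_count.
rewrite -(pair_count (x := y) (y := x)) 1?eq_sym //.
  by congr #|pred_of_set _|; apply/setP => i; rewrite !inE andbC.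
by rewrite -opprB yx2.
Qed.

Lemma development_card_block i : #|block r N i| = 3.
Proof.
case: i => [[i x]|[k g]] /=.
  by rewrite setUC cardsU1 cards2 !inE !inl_eqE !xpair_eqE !andbF.
have : uniq (arm k) by apply: count_mem_uniq => x; rewrite -arm_mem.
rewrite /arm /= !inE negb_or !andbT => /andP[/andP[ab ac] bc].
rewrite setUC cardsU1 cards2 !inE !inl_eqE !(inj_eq (addrI g)) ab.
by rewrite eq_sym (negPf ac) eq_sym (negPf bc).
Qed.

Lemma development_nest_notin i : nest_point i \notin block r N i.
Proof.
case: i => [[i x]|[k g]] /=; first by rewrite !inE.
by rewrite (in_arm_block k g g) subrr arm0.
Qed.

(** A further point determines its row, and one point of the block then determines the translate.
    For nests in X, equal nests are handled by [arm_inj]; if the two pairs are crossed, g' - g and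
    its opposite both occur in base triples, which [arm_opp] forbids. *)
Lemma development_nest_pairs i j x y : x \in block r N i -> y \in block r N j ->
  [set x; nest_point i] = [set y; nest_point j] -> i = j /\ x = y.
Proof.
have is_inl w i' : w \in block r N i' -> exists w', w = inl w'.
  by case: i' => [[i' h]|[k g]] /=; rewrite !inE -!orbA => /or3P[] /eqP->; eexists.
move=> xi yj; have [x' xE] := is_inl _ _ xi; have [y' yE] := is_inl _ _ yj.
rewrite {}xE {}yE in xi yj *.
case: i j xi yj => [[i h]|[k g]] [[j h']|[k' g']] xi yj /set2_eq[] [] //=.
- move=> [xy] [ij]; split; last by rewrite xy.
  move: xi yj; rewrite -xy -ij [x']surjective_pairing !in_row_block => /eqP -> /eqP/addIr->.
  by [].
- move=> [xy] [gg]; move: xi yj; rewrite -xy -gg !in_arm_block => xk xk'.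
  by rewrite (arm_inj xk xk').
- move=> [xg] [gy]; move: xi yj; rewrite xg -gy !in_arm_block => xk.
  by rewrite -opprB (negPf (arm_opp k' xk)).
Qed.

End Development.

Lemma starter_nested_design (N : seq (G * G * G)) :
  injective (fun x : H => x + x) -> starter N ->
  exists (T : finType) (X Y : {set T}) (A : seq {set T}) (phi : 'I_(size A) -> T),
     [/\ is_BIBD (6 * t + 3) 3 2 X A, strong_nesting X Y phi & #|Y| = (9 * t + 5)%N].
Proof.
move=> dbl_inj N_starter.
have [_ _ _ mixed_uniq [size_M sum_M]] := N_starter.
have [r r_completes] := completion dbl_inj mixed_uniq size_M sum_M.
pose X := [set inl g | g : G] : {set G + 'I_(3 * t + 2)}.
have in_X g : inl g \in X by apply: imset_f.
have card_G : #|{: G}| = (6 * t + 3)%N by rewrite card_prod card_H (card_ord 3); lia.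
have [||||||||A [phi [bibd nesting]]] :=
  @indexed_nested_design _ _ (6 * t + 3) X [set: G + 'I_(3 * t + 2)] (block r N) nest_point.
- by rewrite card_imset ?card_G // => x y [].
- move=> i; apply/subsetP; case: i => [[i x]|[k g]] w /=;
    by rewrite !inE -!orbA => /or3P[] /eqP->; apply: in_X.
- exact: development_card_block.
- move=> _ _ /imsetP[x _ ->] /imsetP[y _ ->] xy.
  by apply: development_covers_twice => //; apply: contraNneq xy => ->.
- exact: subsetT.
- by move=> i; rewrite inE.
- exact: development_nest_notin.
- exact: development_nest_pairs.
exists _, X, setT, A, phi; split=> //.
by rewrite cardsT card_sum card_G card_ord; lia.
Qed.

End Starter.

(** * From progressions to starters *)

Definition zmodZ (m : nat) (x : Z) : 'Z_m := (int_of_Z x)%:~R.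

Lemma zmodZD m x y : zmodZ m (x + y)%R = zmodZ m x + zmodZ m y.
Proof. by rewrite /zmodZ raddfD /= rmorphD. Qed.

Lemma zmodZN m x : zmodZ m (- x)%R = - zmodZ m x.
Proof. by rewrite /zmodZ raddfN /= rmorphN. Qed.

Lemma zmodZB m x y : zmodZ m (x - y)%R = zmodZ m x - zmodZ m y.
Proof. by rewrite /zmodZ raddfB /= rmorphB. Qed.

Lemma natr_Zp_eq0 m k : (1 < m)%N -> k%:R = 0 :> 'Z_m -> (m %| k)%N.
Proof. by move=> m1 /(congr1 val) /=; rewrite val_Zp_nat // => /eqP. Qed.

Lemma zmodZ_eq0 m x : (1 < m)%N -> zmodZ m x = 0 -> Z.divide (Z.of_nat m) x.
Proof.
rewrite /zmodZ => m1; case: x => [|p|p] /= H.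
- exact: Z.divide_0_r.
- have /dvdnP[k pk] := natr_Zp_eq0 m1 H.
  by exists (Z.of_nat k); lia.
- move: H; rewrite NegzE rmorphN => /eqP; rewrite oppr_eq0 => /eqP H.
  have /dvdnP[k pk] := natr_Zp_eq0 m1 H.
  by exists (- Z.of_nat k)%Z; lia.
Qed.

Lemma zmodZ_dvd m x : (1 < m)%N -> Z.divide (Z.of_nat m) x -> zmodZ m x = 0.
Proof.
move=> m1 [w ->]; have -> : (w * Z.of_nat m)%Z = (w * Z.of_nat m)%R by [].
rewrite /zmodZ rmorphM /= rmorphM /=.
have -> : int_of_Z (Z.of_nat m) = m%:Z by lia.
by rewrite [X in _ * X](_ : _ = m%:R) // pchar_Zp // mulr0.
Qed.

Lemma perm_flatten_swap (T : eqType) (I : Type) (fs : seq (I -> T)) (s : seq I) :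
  perm_eq (flatten [seq [seq f k | f <- fs] | k <- s])
          (flatten [seq [seq f k | k <- s] | f <- fs]).
Proof.
apply/permP => p; rewrite !count_flatten -!map_comp !sumnE !big_map.
transitivity (\sum_(k <- s) \sum_(f <- fs) p (f k))%N.
  by apply: eq_bigr => k _; rewrite /= count_map -sum1_count big_mkcond;
    apply: eq_bigr => f _ /=; case: (p _).
rewrite exchange_big; apply: eq_bigr => f _ /=.
by rewrite count_map -sum1_count [RHS]big_mkcond; apply: eq_bigr => k _ /=; case: (p _).
Qed.

Lemma mem_uniq_full (T : finType) (s : seq T) x : uniq s -> size s = #|T| -> x \in s.
Proof.
move=> /card_uniqP card_s size_s.
by have /subset_cardP/(_ (subset_predT _)) -> : #|s| = #|T| by rewrite card_s.
Qed.

Lemma qev_add a b x : qev (qadd a b) x = (qev a x + qev b x)%Z.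
Proof. by rewrite /qev /=; lia. Qed.

Lemma qev_mul a b x : qev (qmul a b) x = (ev a x * ev b x)%Z.
Proof. by rewrite /qev /ev /=; lia. Qed.

(** * The starter given by a table entry *)

Section Entry.
Variables (e : starter_entry) (q : nat).
Local Notation Q := (Z.of_nat q).
Hypotheses (e_ok : entry_ok e) (q_large : (e_q0 e <= Q)%Z).
Let F := e_fams e.
Let t := Z.to_nat (ev (e_t e) Q).
Let n := (2 * t + 1)%N.
Local Notation G := ('Z_n * 'Z_3)%type.
Let nZ := ladd (1%Z, 0%Z) (lscale 2%Z (e_t e)).

Definition progression_elt (g : progression) (k : nat) : G :=
  (zmodZ n (pval g Q (Z.of_nat k)), zmodZ 3 (plevel g)).
Definition progression_size (g : progression) : nat := Z.to_nat (ev (plength g) Q).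
Definition progression_seq (g : progression) : seq G :=
  [seq progression_elt g k | k <- iota 0 (progression_size g)].

Definition family_triples (f : triple_family) : seq (G * G * G) :=
  [seq (progression_elt (arm1 f) k, progression_elt (arm2 f) k, progression_elt (arm3 f) k)
    | k <- iota 0 (progression_size (arm1 f))].
Definition entry_triples : seq (G * G * G) := flatten [seq family_triples f | f <- F].

Lemma t_gt0 : (0 < t)%N.
Proof.
case/and5P: e_ok => _ /posb_ev/(_ q_large) tpos _ _ _.
by rewrite /t; lia.
Qed.

Lemma n_gt1 : (1 < n)%N.
Proof. by rewrite /n; have := t_gt0; lia. Qed.

Lemma evn : ev nZ Q = Z.of_nat n.
Proof.
rewrite /nZ ev_add ev_scale /n /t.
case/and5P: e_ok => _ /posb_ev/(_ q_large) tpos _ _ _.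
have -> : ev (1%Z, 0%Z) Q = 1%Z by [].
by lia.
Qed.

Lemma progression_eltN g k : progression_elt (popp g) k = - progression_elt g k.
Proof.
rewrite /progression_elt /= zmodZN; congr (_, _).
by rewrite -zmodZN; congr zmodZ; rewrite /pval /popp /= ev_scale; lia.
Qed.

Lemma progression_eltB g h k : progression_elt (psub g h) k = progression_elt g k - progression_elt h k.
Proof.
rewrite /progression_elt /= zmodZB; congr (_, _).
by rewrite -zmodZB; congr zmodZ; rewrite /pval /psub /= ev_sub; lia.
Qed.

(** The left side lists the elements triple by triple, the right side progression by progression;
    within a family this is the transposition of a rectangular array. The generic form serves nest
    elements and differences alike. *)
Lemma perm_families (T : eqType) (I : Type) (r : seq triple_family) (h : G * G * G -> seq T)
    (S : triple_family -> seq I) (v : I -> nat -> T) (m : I -> nat) :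
  (forall f, [seq m g | g <- S f] = [seq progression_size (arm1 f) | _ <- S f]) ->
  (forall f k, h (progression_elt (arm1 f) k, progression_elt (arm2 f) k, progression_elt (arm3 f) k) =
    [seq v g k | g <- S f]) ->
  perm_eq (flatten [seq h p | p <- flatten [seq family_triples f | f <- r]])
    (flatten [seq [seq v g k | k <- iota 0 (m g)] | g <- flatten [seq S f | f <- r]]).
Proof.
move=> mS hS; elim: r => //= f r IHr.
rewrite !map_cat !flatten_cat perm_cat //.
have -> : [seq [seq v g k | k <- iota 0 (m g)] | g <- S f] =
    [seq [seq v g k | k <- iota 0 (progression_size (arm1 f))] | g <- S f].
  by elim: (S f) (mS f) => //= g s IHs [-> /IHs ->].
rewrite -map_comp (eq_map (hS f)) -(map_id (S f)) -/(map _ _).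
have -> : [seq [seq v g k | k <- iota 0 (progression_size (arm1 f))] | g <- [seq i | i <- S f]] =
    [seq [seq w k | k <- iota 0 (progression_size (arm1 f))] | w <- [seq v g | g <- S f]].
  by rewrite map_id -map_comp.
have -> : [seq [seq v g k | g <- [seq i | i <- S f]] | k <- iota 0 (progression_size (arm1 f))] =
    [seq [seq w k | w <- [seq v g | g <- S f]] | k <- iota 0 (progression_size (arm1 f))].
  by apply: eq_map => k; rewrite map_id -map_comp.
exact: perm_flatten_swap.
Qed.

Lemma perm_nest_elements :
  perm_eq (nest_elements entry_triples) (flatten [seq progression_seq g | g <- nest_progressions F]).
Proof.
apply: (@perm_families _ _ _ _ _ progression_elt progression_size) => [f|f k] //=.
by rewrite !progression_eltN.
Qed.

Lemma perm_differences : perm_eq (differences entry_triples)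
  (flatten [seq progression_seq d.2 | d <- difference_progressions F]).
Proof.
apply: (@perm_families _ _ _ _ _ (fun d => progression_elt d.2)
  (fun d => progression_size d.2)) => [f|f k] //=.
by rewrite !progression_eltB.
Qed.

Lemma mem_progression_seq x g : x \in progression_seq g ->
  exists k, [/\ (0 <= Z.of_nat k < ev (plength g) Q)%Z & x = progression_elt g k].
Proof.
case/mapP => k; rewrite mem_iota add0n /progression_size => k_lt ->; exists k; split=> //.
by lia.
Qed.

Lemma progression_elt_dvd g h k k' : progression_elt g k = progression_elt h k' ->
  Z.divide (ev nZ Q) (pval g Q (Z.of_nat k) - pval h Q (Z.of_nat k'))%Z /\
  Z.divide 3 (plevel g - plevel h)%Z.
Proof.
case=> e1 e2; rewrite evn; split.
  by apply: zmodZ_eq0 n_gt1 _; rewrite zmodZB e1 subrr.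
by apply: (@zmodZ_eq0 3) => //; rewrite zmodZB e2 subrr.
Qed.

Lemma separated_uniq S : separated nZ (e_q0 e) S -> uniq (flatten [seq progression_seq g | g <- S]).
Proof.
rewrite /separated; elim: S => //= g S IHS /andP[/andP[g_inj S_inj] /andP[g_disj S_disj]].
rewrite cat_uniq IHS ?S_inj // andbT; apply/andP; split.
  rewrite map_inj_in_uniq ?iota_uniq // => k k'; rewrite !mem_iota !add0n /progression_size => kl kl' ek.
  have [dv _] := progression_elt_dvd ek.
  by have := @injective_modP _ _ _ _ _ _ g_inj q_large _ _ dv; lia.
apply/hasPn => x xS; apply/negP => /mem_progression_seq[k [kl xE]].
elim: S xS g_disj {IHS S_inj S_disj} => //= h S IHS.
rewrite mem_cat => /orP[xh|xS] /andP[gh gS]; last exact: IHS xS gS.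
case/mem_progression_seq: xh => k' [kl']; rewrite xE => ek; have [dv lev] := progression_elt_dvd ek.
exact: (disjoint_modP gh q_large kl kl' lev dv).
Qed.

Lemma progression_seq_zero : progression_seq zero_progression = [:: 0].
Proof. by []. Qed.

(** Positive lengths make the truncating [Z.to_nat] additive here. *)
Lemma size_progression_seqs S : all (fun g => posb (e_q0 e) (plength g)) S ->
  size (flatten [seq progression_seq g | g <- S]) = Z.to_nat (ev (total_length S) Q).
Proof.
elim: S => //= g S IHS /andP[/posb_ev/(_ q_large) g_pos S_pos].
rewrite size_cat IHS // size_map size_iota /progression_size /total_length /= ev_add.
suff : (0 <= ev (foldr ladd (0, 0)%Z [seq plength g0 | g0 <- S]) Q)%Z by lia.
elim: S S_pos {IHS} => //= h S IHS /andP[/posb_ev/(_ q_large) h_pos /IHS].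
by rewrite ev_add; lia.
Qed.

Lemma progression_level l g x : at_level l g -> x \in progression_seq g -> x.2 = zmodZ 3 l.
Proof.
rewrite /at_level => /Z.eqb_eq lev /mem_progression_seq[k [_ ->]] /=.
apply/eqP; rewrite -subr_eq0 -zmodZB; apply/eqP; apply: zmodZ_dvd => //.
by apply/Z.mod_divide.
Qed.

Lemma at_levelP l g : zmodZ 3 (plevel g) = zmodZ 3 l -> at_level l g.
Proof.
move=> e2; apply/Z.eqb_eq/Z.mod_divide => //.
by apply: (@zmodZ_eq0 3) => //; rewrite (zmodZB 3 (plevel g) l) e2 subrr.
Qed.

Lemma lens_pos : all (fun f : triple_family => posb (e_q0 e) f.1.1) F.
Proof. by case/and5P: e_ok. Qed.

Lemma difference_lens (p : pred (bool * progression)) :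
  all (fun g => posb (e_q0 e) (plength g)) [seq d.2 | d <- difference_progressions F & p d].
Proof.
have := lens_pos; rewrite /difference_progressions; elim: (F) => //= f r IHr /andP[f_pos /IHr r_pos].
by do 6![case: (p _) => /=; rewrite ?f_pos /=].
Qed.

(** Pigeonhole: the 2t terms of one colour are distinct, nonzero and at level 0, so with 0 they fill
    Z_n. *)
Lemma pure_count c (h : 'Z_n) : h != 0 ->
  count_mem (h, 0) (flatten [seq progression_seq g | g <- pure_progressions F c]) = 1%N.
Proof.
move=> h0.
have sep : separated nZ (e_q0 e) (zero_progression :: pure_progressions F c).
  by case/and5P: e_ok => _ _ _ _ /and4P[? ? _ _]; case: c.
have len : lin_eqb (total_length (pure_progressions F c)) (lscale 2 (e_t e)).
  by case/and5P: e_ok => _ _ _ _ /and4P[_ _ _ /and5P[_ ? ? _ _]]; clear sep; case: c.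
set L := flatten _.
have : uniq (progression_seq zero_progression ++ L) := separated_uniq sep.
rewrite progression_seq_zero cat_uniq => /and3P[_ zeroL L_uniq].
have {}zeroL : 0 \notin L by apply: contra zeroL => ?; apply/hasP; exists 0; rewrite ?mem_head.
have L2 x : x \in L -> x = (x.1, 0).
  rewrite /L /pure_progressions; elim: (difference_progressions F) => //= d r IHr.
  case: ifP => [/andP[lev _]|_]; last exact: IHr.
  rewrite /= mem_cat => /orP[/(progression_level lev) x2|]; last exact: IHr.
  by rewrite [LHS]surjective_pairing x2.
rewrite count_uniq_mem //; suff -> : (h, 0) \in L by [].
have size_L : size L = (2 * t)%N.
  rewrite /L size_progression_seqs ?difference_lens //.
  move: len => /andP[/Z.eqb_eq l1 /Z.eqb_eq l2].
  have -> : ev (total_length (pure_progressions F c)) Q = ev (lscale 2%Z (e_t e)) Q by rewrite /ev l1 l2.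
  by rewrite ev_scale /t; lia.
have : h \in 0 :: [seq x.1 | x <- L].
  apply: mem_uniq_full.
    rewrite /= map_inj_in_uniq ?L_uniq ?andbT.
      by apply: contra zeroL => /mapP[x xL x0]; move: (xL); rewrite (L2 x xL) -x0.
    by move=> x y xL yL xy; rewrite (L2 x xL) (L2 y yL) xy.
  by rewrite /= size_map size_L card_ord Zp_cast ?n_gt1 //; rewrite /n addn1.
by rewrite inE (negPf h0) => /mapP[x xL ->]; rewrite -(L2 x xL).
Qed.

Lemma entry_pure (h : 'Z_n) : h != 0 -> count_mem (h, 0) (differences entry_triples) = 2%N.
Proof.
move=> h0; rewrite (permP perm_differences).
transitivity (count_mem ((h, 0%R) : G) (flatten [seq progression_seq g | g <- pure_progressions F true]) +
    count_mem ((h, 0%R) : G) (flatten [seq progression_seq g | g <- pure_progressions F false]))%N;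
  last by rewrite !pure_count.
rewrite /pure_progressions.
elim: (difference_progressions F) => //= d r IHr; rewrite !count_cat IHr.
have [lev|/negPf lev] := boolP (at_level 0 d.2); last first.
  rewrite /= (_ : count _ (progression_seq d.2) = 0%N) //; apply/eqP; rewrite -leqn0 leqNgt -has_count.
  apply/hasPn => x /mem_progression_seq[k [_ ->]] /=; apply/negP => /eqP[_ e2].
  by case/negP: lev; apply: at_levelP.
by case: d.1; rewrite /= !count_cat; [rewrite addnA | rewrite [RHS]addnCA].
Qed.

Lemma entry_mixed : perm_eq (mixed_differences entry_triples)
  [seq x.1 | x <- flatten [seq progression_seq g | g <- mixed_progressions F]].
Proof.
have := perm_map fst (perm_filter (fun d : G => d.2 == 1) perm_differences).
suff -> : [seq x <- flatten [seq progression_seq d.2 | d <- difference_progressions F] | x.2 == 1] =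
   flatten [seq progression_seq g | g <- mixed_progressions F] by [].
rewrite /mixed_progressions; elim: (difference_progressions F) => //= d r IHr.
rewrite filter_cat IHr; have [lev|/negPf lev] := boolP (at_level 1 d.2).
  by rewrite /=; congr (_ ++ _); apply/all_filterP/allP => x /(progression_level lev) ->.
rewrite (_ : filter _ (progression_seq d.2) = [::]) //; apply/eqP; rewrite -(negbK (_ == _)) -has_filter.
apply/hasPn => x /mem_progression_seq[k [_ ->]] /=; apply/negP => /eqP e2.
by case/negP: lev; apply: at_levelP.
Qed.

Lemma size_entry_triples : size entry_triples = t.
Proof.
have -> : size entry_triples =
    size (flatten [seq progression_seq g | g <- [seq arm1 f | f <- F]]).
  rewrite /entry_triples; elim: F => //= f r IHr.
  by rewrite !size_cat IHr !size_map.
rewrite size_progression_seqs /t; last by have := lens_pos; rewrite all_map; apply: sub_all.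
case/and5P: e_ok => _ _ _ _ /and4P[_ _ _ /and5P[/andP[/Z.eqb_eq l1 /Z.eqb_eq l2] _ _ _ _]].
by rewrite /ev l1 l2.
Qed.

Lemma entry_nests : uniq (0 :: nest_elements entry_triples).
Proof.
have sep : separated nZ (e_q0 e) (zero_progression :: nest_progressions F).
  by case/and5P: e_ok => _ _ _ ->.
rewrite (@perm_uniq _ _ (progression_seq zero_progression ++
    flatten [seq progression_seq g | g <- nest_progressions F])).
  exact: (separated_uniq sep).
by rewrite progression_seq_zero /= perm_cons perm_nest_elements.
Qed.

Lemma mixed_level x : x \in flatten [seq progression_seq g | g <- mixed_progressions F] -> x.2 = 1.
Proof.
rewrite /mixed_progressions; elim: (difference_progressions F) => //= d r IHr.
case: ifP => [lev|_]; last exact: IHr.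
by rewrite /= mem_cat => /orP[/(progression_level lev)|]; last exact: IHr.
Qed.

Lemma uniq_mixed : uniq (mixed_differences entry_triples).
Proof.
rewrite (perm_uniq entry_mixed) map_inj_in_uniq.
  by apply: separated_uniq; case/and5P: e_ok => _ _ _ _ /and4P[].
move=> [x a] [y b] /mixed_level /= -> /mixed_level /= ->.
by move=> ->.
Qed.

Lemma size_mixed : size (mixed_differences entry_triples) = t.
Proof.
rewrite (perm_size entry_mixed) size_map size_progression_seqs ?difference_lens // /t.
case/and5P: e_ok => _ _ _ _ /and4P[_ _ _ /and5P[_ _ _ /andP[/Z.eqb_eq l1 /Z.eqb_eq l2] _]].
by rewrite /ev l1 l2.
Qed.

Lemma doubling_injective : injective (fun x : 'Z_n => x + x).
Proof.
move=> x y /= xy.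
(* The inverse of 2 modulo n is t+1, because 2(t+1) = n+1. *)
have triv (z : 'Z_n) : z = (z + z) *+ t.+1.
  rewrite -mulr2n -mulrnA -[LHS]addr0 -[X in _ + X](mul0r z) -(pchar_Zp n_gt1) mulr_natl -mulrS.
  by congr (_ *+ _); rewrite /n; lia.
by rewrite (triv x) xy -triv.
Qed.

Lemma double_progression (b s : Z) (l : nat) :
  (\sum_(0 <= k < l) zmodZ n (b + s * Z.of_nat k)) *+ 2 =
  zmodZ n (Z.of_nat l * (2 * b + s * (Z.of_nat l - 1)))%Z.
Proof.
elim: l => [|l IHl]; first by rewrite big_geq // mul0rn.
rewrite big_nat_recr // mulrnDl {}IHl mulr2n -!zmodZD; congr zmodZ.
have -> : Z.of_nat l.+1 = (Z.of_nat l + 1)%Z by lia.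
by lia.
Qed.

(** Vanishing may be tested after doubling, and twice the sum is a quadratic polynomial in q that
    the entry certifies to be n times [e_quot]. *)
Lemma sum_mixed : \sum_(h <- mixed_differences entry_triples) h = 0.
Proof.
apply: doubling_injective; rewrite addr0 -mulr2n (perm_big _ entry_mixed) /= big_map.
have -> : (\sum_(x <- flatten [seq progression_seq g | g <- mixed_progressions F]) x.1) *+ 2 =
    zmodZ n (qev (double_sum (mixed_progressions F)) Q).
  have := difference_lens (fun d => at_level 1 d.2); rewrite -/(mixed_progressions F).
  elim: (mixed_progressions F) => [|g S IHS] /=; first by rewrite big_nil mul0rn.
  move=> /andP[/posb_ev/(_ q_large) g_pos /IHS {}IHS].
  rewrite big_cat mulrnDl IHS qev_add [RHS](zmodZD n (qev _ Q)) big_map; congr (_ + _).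
  transitivity ((\sum_(0 <= k < progression_size g) zmodZ n (ev (pbase g) Q + pstep g * Z.of_nat k))
      *+ 2).
    by rewrite /index_iota subn0.
  rewrite double_progression; congr zmodZ.
  rewrite qev_mul ev_add !ev_scale ev_sub /progression_size.
  have -> : ev (1%Z, 0%Z) Q = 1%Z by [].
  by rewrite Z2Nat.id; lia.
case/and5P: e_ok => _ _ _ _ /and4P[_ _ _ /and5P[_ _ _ _ sum_ok]].
have -> : qev (double_sum (mixed_progressions F)) Q = (ev nZ Q * ev (e_quot e) Q)%Z.
  rewrite -qev_mul; case/and3P: sum_ok => /Z.eqb_eq a /Z.eqb_eq b /Z.eqb_eq c.
  by rewrite /qev a b c.
by apply: zmodZ_dvd n_gt1 _; rewrite evn; exact: Z.divide_factor_l.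
Qed.

Lemma entry_starter : starter t entry_triples.
Proof.
split; first exact: size_entry_triples.
- exact: entry_nests.
- exact: entry_pure.
- exact: uniq_mixed.
- by split; [exact: size_mixed | exact: sum_mixed].
Qed.

Lemma entry_design : exists (T : finType) (X Y : {set T}) (A : seq {set T}) (phi : 'I_(size A) -> T),
  [/\ is_BIBD (6 * t + 3) 3 2 X A, strong_nesting X Y phi & #|Y| = (9 * t + 5)%N].
Proof.
apply: starter_nested_design doubling_injective entry_starter.
by rewrite card_ord Zp_cast ?n_gt1.
Qed.
End Entry.

(** * Covering all values of t *)

Local Open Scope nat_scope.

Definition reaches (t : nat) (e : starter_entry) (q : nat) : bool :=
  (e_q0 e <=? Z.of_nat q)%Z && (ev (e_t e) (Z.of_nat q) =? Z.of_nat t)%Z.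

(** Below 36 = 12 * 3 the parameter q is at most 2, whence [iota 0 3]; from 36 on it is at least 3,
    which meets the thresholds checked in [table_large]. The exceptions t = 1 and t = 3 are v = 9
    and v = 21. *)
Lemma table_small : all (fun t => (t == 1) || (t == 3) ||
  has (fun e => has (reaches t e) (iota 0 3)) starter_table) (iota 1 35).
Proof. by vm_compute. Qed.

Lemma table_large : all (fun r =>
  has (fun e => lin_eqb (e_t e) (Z.of_nat r, 12%Z) && (e_q0 e <=? 3)%Z) starter_table) (iota 0 12).
Proof. by vm_compute. Qed.

(* [starter_entry] has no [eqType] structure, so [x \in s] is expressed through the predicates that
   hold throughout [s]. *)
Lemma has_exists (T : Type) (p : pred T) (s : seq T) :
  has p s -> exists x, p x /\ forall a : pred T, all a s -> a x.
Proof.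
elim: s => //= x s IHs /orP[px|/IHs[y [py ys]]].
  by exists x; split=> // a /andP[].
by exists y; split=> // a /andP[_ /ys].
Qed.

Lemma reaches_design t e q : entry_ok e -> reaches t e q ->
  exists (T : finType) (X Y : {set T}) (A : seq {set T}) (phi : 'I_(size A) -> T),
  [/\ is_BIBD (6 * t + 3) 3 2 X A, strong_nesting X Y phi & #|Y| = 9 * t + 5].
Proof.
move=> e_ok /andP[/Z.leb_le qq /Z.eqb_eq tE].
have := entry_design e_ok qq; rewrite tE.
by rewrite Nat2Z.id.
Qed.

Lemma table_covers t : 0 < t -> t != 1 -> t != 3 -> exists e q, entry_ok e /\ reaches t e q.
Proof.
move=> t0 t1 t3; case: (ltnP t 36) => t36.
  have /allP/(_ t) := table_small; rewrite mem_iota t0 => /(_ t36).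
  rewrite (negPf t1) (negPf t3) !orFb => /has_exists[e [/has_exists[q [eq _]] e_ok]].
  by exists e, q; split=> //; apply: e_ok starter_table_ok.
have /allP/(_ (t %% 12)) := table_large; rewrite mem_iota ltn_mod => /(_ isT).
move=> /has_exists[e [/andP[/andP[/Z.eqb_eq e1 /Z.eqb_eq e2] /Z.leb_le e3] e_ok]].
exists e, (t %/ 12); split; first exact: e_ok starter_table_ok.
rewrite /reaches /ev e1 e2 [fst _]/= [snd _]/=.
apply/andP; split; [apply/Z.leb_le | apply/Z.eqb_eq].
  have : 3 <= t %/ 12 by rewrite leq_divRL. lia.
have := divn_eq t 12. lia.
Qed.

Theorem theorem4p4 (v : nat) :
  v %% 6 = 3 -> 9 <= v ->
  (exists (T : finType) (X Y : {set T}) (A : seq {set T})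
          (phi : 'I_(size A) -> T),
     [/\ is_BIBD v 3 2 X A, strong_nesting X Y phi & #|Y| = (3 * v + 1) %/ 2])
  /\
  (forall (T : finType) (X Y : {set T}) (A : seq {set T})
          (phi : 'I_(size A) -> T),
     is_BIBD v 3 2 X A -> strong_nesting X Y phi ->
     (3 * v + 1) %/ 2 <= #|Y|).
Proof.
move=> v6 v9; split; last by move=> T X Y A phi bibd nesting; apply: strong_nesting_card bibd nesting v6.
pose t := v %/ 6; have vE : v = 6 * t + 3 by rewrite mulnC {1}(divn_eq v 6) v6.
have t0 : 0 < t by rewrite divn_gt0 // (leq_trans _ v9).
have -> : (3 * v + 1) %/ 2 = 9 * t + 5.
  by rewrite vE (_ : 3 * (6 * t + 3) + 1 = (9 * t + 5) * 2) ?mulnK //; lia.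
rewrite vE; case: (eqVneq t 1) => [->|t1]; first exact: listed_design design9_ok.
case: (eqVneq t 3) => [->|t3]; first exact: listed_design design21_ok.
by have [e [q [e_ok /reaches_design]]] := table_covers t0 t1 t3; apply.
Qed.
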